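(* Let $A^\delta$ be a discrete annulus of mesh size $\delta$, $a^\delta$ a point of its outer boundary, $c^\delta$ a cut, $\varepsilon>0$, and let $d_1^\delta,d_2^\delta$ be two cuts that disconnect $c^\delta$ from the points of $A^\delta$ at distance more than $\varepsilon$ from $c^\delta$; put $d^\delta=d^\delta_1\cup d_2^\delta$. Then the exploration process $e^\delta_{A^\delta}$ is absolutely continuous with respect to the process $e^\delta_{A^\delta\setminus c^\delta}$, until the first hitting time $T_{c^\delta}^\varepsilon$ of the $\varepsilon$-neighborhood of the cut $c^\delta$. Explicitly, letting $\gamma^\delta$ be a curve defined until it first hits the $\varepsilon$-neighborhood of $c^\delta$, we have (for any mesh size $\delta\ll\varepsilon$) $$\frac{\mathbb{P}[e^\delta_{A^\delta}\text{ starts by }\gamma^\delta]}{\mathbb{P}[e^\delta_{A^\delta\setminus c^\delta}\text{ starts by }\gamma^\delta]}=\frac{\det\big(\mathrm{Id}-\mathcal{H}^{c^\delta\to d^\delta}_{A^\delta\setminus K^\delta}\circ\mathcal{H}^{d^\delta\to c^\delta}_{A^\delta\setminus K^\delta}\big)}{\det\big(\mathrm{Id}-\mathcal{H}^{c^\delta\to d^\delta}_{A^\delta}\circ\mathcal{H}^{d^\delta\to c^\delta}_{A^\delta}\big)},$$ where $K^\delta$ is the image of $\gamma^\delta$, and carries Neumann conditions on the arc $\mathcal{B}_{K^\delta}$, the counterclockwise arc from $a^\delta$ to $\gamma^\delta(T^\varepsilon_{c^\delta})$ (Dirichlet conditions elsewhere).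
   Context: A discrete annulus $A^\delta$ is a doubly-connected union of faces of $\delta\mathbb{Z}^2$, also seen as a graph. A discrete cut is a simple lattice curve connecting the two boundary components of $A^\delta$. Uniform spanning tree (UST): given a graph with boundary vertices each declared wired or free, contract all wired vertices into one vertex, delete free vertices and the edges having a free endpoint, and take a uniform spanning tree of the resulting graph, viewed as a subgraph. ''Wired'' means that all boundary vertices are wired. $e^\delta_{A^\delta}$ and $e^\delta_{A^\delta\setminus c^\delta}$ are the exploration processes started at $a^\delta$ of the wired UST in $A^\delta$ (outer component) and in the simply-connected domain $A^\delta\setminus c^\delta$ ($c^\delta$ is also wired) respectively. The exploration process of a tree $T$ is the path on $(\delta/4,\delta/4)+\frac\delta2\mathbb{Z}^2$ following counterclockwise the contour of $T$, crossing neither $T$ nor its dual graph (the edges of $\delta\mathbb{Z}^2+(\delta/2,\delta/2)$ crossing edges not in $T$), with $T$ on its right and the dual graph on its left. $\gamma^\delta$ is a possible initial segment of such an exploration. Conditionally on the exploration starting by $\gamma^\delta$, the UST in the unexplored domain $A^\delta\setminus K^\delta$ is a UST with free conditions on the left side of $\gamma^\delta$ (the arc $\mathcal{B}_{K^\delta}$) and wired conditions on the rest of $\partial K^\delta$. Harmonic extension. Free corresponds to Neumann and wired to Dirichlet. For disjoint (unions of) discrete cuts $\alpha^\delta,\beta^\delta$ in a discrete domain $D^\delta$ and $f$ a function on $\alpha^\delta$, let $F$ be the discrete harmonic function on $D^\delta\setminus\alpha^\delta$ (for $\Delta F(z)=\sum_{w\sim z}(F(w)-F(z))$) equal to $f$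 on $\alpha^\delta$, zero on the Dirichlet boundary of $D^\delta$, and with zero increment along every edge linking the Neumann boundary to the interior; then $\mathcal{H}^{\alpha^\delta\to\beta^\delta}_{D^\delta}f=F|_{\beta^\delta}$. The operators inside the determinants act on functions on $d^\delta$. *)

(* Defs.v *)
From mathcomp Require Import all_boot all_order all_algebra finmap.
From mathcomp Require Import boolp classical_sets reals.

Set Implicit Arguments.
Unset Strict Implicit.
Unset Printing Implicit Defensive.

Import Order.TTheory GRing.Theory Num.Theory.
Local Open Scope fset_scope.
Local Open Scope ring_scope.

(** * The square lattice

    All objects are indexed by integers; the mesh size [delta] enters through
    Euclidean distances only.  The vertex [v] is the point [delta * v] of the
    plane, and the face [f] is the square of side [delta] whose lower left
    corner is the vertex [f].  The edge [(v, false)] goes from [v] to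
    [v + (1, 0)] and the edge [(v, true)] from [v] to [v + (0, 1)]. *)

Notation vertex := (int * int)%type (only parsing).
Notation face := (int * int)%type (only parsing).
Notation edge := (vertex * bool)%type (only parsing).

Definition right : vertex := (1, 0).
Definition up : vertex := (0, 1).

Definition ends (e : edge) : vertex * vertex :=
  (e.1, e.1 + (if e.2 then up else right)).

Definition joins (e : edge) (x y : vertex) : bool :=
  (ends e == (x, y)) || (ends e == (y, x)).

Definition corners (f : face) : seq vertex :=
  [:: f; f + right; f + up; f + right + up].

Definition sides (f : face) : seq edge :=
  [:: (f, false); (f, true); (f + up, false); (f + right, true)].

Definition faces_at (v : vertex) : seq face :=
  [:: v; v - right; v - up; v - right - up].

Definition faces_along (e : edge) : seq face :=
  [:: e.1; e.1 - (if e.2 then right else up)].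

Definition dist (R : realType) (delta : R) (u v : vertex) : R :=
  delta * Num.sqrt ((u.1 - v.1)%:~R ^+ 2 + (u.2 - v.2)%:~R ^+ 2).

(** * Unions of faces, discrete annuli, cuts *)

Definition verts (F : {fset face}) : {fset vertex} :=
  [fset v | f in F, v in corners f].

Definition edges (F : {fset face}) : {fset edge} :=
  [fset e | f in F, e in sides f].

Definition bd_verts (F : {fset face}) : {fset vertex} :=
  [fset v in verts F | has (fun f => f \notin F) (faces_at v)].

Definition bd_edges (F : {fset face}) : {fset edge} :=
  [fset e in edges F | has (fun f => f \notin F) (faces_along e)].

Definition share_side (f g : face) : bool :=
  (`|f.1 - g.1| + `|f.2 - g.2| == 1)%N.

Definition share_corner (f g : face) : bool :=
  (`|f.1 - g.1| <= 1)%N && (`|f.2 - g.2| <= 1)%N.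

Definition connected (adj : rel face) (P : pred face) : Prop :=
  forall f g : face, P f -> P g ->
    exists s : seq face, [/\ path adj f s, all P s & last f s = g].

(** The domain is the interior of the union of the faces of [F]: it is
    connected, and its closed complement has exactly two components, the
    bounded one being the union of the faces of [hole].  Faces meeting at a
    corner only are thus connected in the complement but not in the domain. *)
Record annulus : Type := Annulus {
  faces : {fset face};
  hole : {fset face};
  faces_connected : connected share_side (fun f => f \in faces);
  hole_neq0 : hole != fset0;
  hole_disjoint : [disjoint faces & hole];
  hole_connected : connected share_corner (fun f => f \in hole);
  outside_connected :
    connected share_corner (fun f => f \notin faces `|` hole);
  hole_outside : forall f g : face,
    f \in hole -> g \notin faces `|` hole -> ~~ share_corner f g
}.

Definition outer_bd (A : annulus) : {fset vertex} :=
  [fset v in verts (faces A)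
     | has (fun f => f \notin faces A `|` hole A) (faces_at v)].

Definition inner_bd (A : annulus) : {fset vertex} :=
  [fset v in verts (faces A) | has (fun f => f \in hole A) (faces_at v)].

Definition adjacent (E : {fset edge}) (x y : vertex) : bool :=
  has (fun e => joins e x y) E.

Definition is_cut (A : annulus) (c : seq vertex) : bool :=
  if c is x :: p then
    [&& uniq c, path (adjacent (edges (faces A))) x p,
        x \in outer_bd A & last x p \in inner_bd A]
  else false.

Definition curve_verts (c : seq vertex) : {fset vertex} := [fset v in c].

Definition curve_edges (E : {fset edge}) (c : seq vertex) : {fset edge} :=
  [fset e in E | has (fun xy => joins e xy.1 xy.2) (zip c (behead c))].

(** [d] disconnects [c] from the vertices at distance more than [eps] of [c].
    The distance of a vertex to a lattice curve is attained at a vertex. *)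
Definition disconnects (R : realType) (delta eps : R) (E : {fset edge})
    (d c : {fset vertex}) : Prop :=
  forall (x : vertex) (p : seq vertex),
    x \in c -> path (adjacent E) x p ->
    (forall u, u \in c -> eps < dist delta (last x p) u) ->
    has (fun v => v \in d) (x :: p).

(** * The wired uniform spanning tree

    The graph with vertices [V] and edges [E] in which the set [W] of wired
    vertices is contracted has vertex set [option (V `\` W)]: the vertex [None]
    is the contracted one, and [insub] is the contraction map.  Its edges are
    those of [E], possibly multiple edges or loops. *)

Section Contraction.
Variables V W : {fset vertex}.

Definition cends (e : edge) : option (V `\` W) * option (V `\` W) :=
  (insub (ends e).1, insub (ends e).2).

Definition cadj (T : {fset edge}) : rel (option (V `\` W)) :=
  fun x y => has (fun e => (cends e == (x, y)) || (cends e == (y, x))) T.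

(** An edge belongs to a cycle when its ends are joined by other edges. *)
Definition acyclic (T : {fset edge}) : bool :=
  all (fun e => ~~ connect (cadj (T `\ e)) (cends e).1 (cends e).2) T.

Definition spanning_tree (T : {fset edge}) : bool :=
  [forall x, forall y, connect (cadj T) x y] && acyclic T.

End Contraction.

Definition wired_trees (V : {fset vertex}) (E : {fset edge})
    (W : {fset vertex}) : {fset {fset edge}} :=
  [fset T in fpowerset E | spanning_tree V W T].

Definition uniform_prob (R : realType) (X : {fset {fset edge}})
    (ev : pred {fset edge}) : R :=
  #|` [fset T in X | ev T]|%:R / #|` X|%:R.

(** * The exploration process

    The pair [q] stands for the point [delta * ((1/4, 1/4) + q / 2)], which lies
    in the face [q_face q]; the nearest vertex is [q_vert q]. *)

Notation qpoint := (int * int)%type (only parsing).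

Definition q_vert (q : qpoint) : vertex :=
  (((q.1 + 1) %/ 2)%Z, ((q.2 + 1) %/ 2)%Z).

Definition q_face (q : qpoint) : face := ((q.1 %/ 2)%Z, (q.2 %/ 2)%Z).

(** With [q_vert q] on its right and the centre of [q_face q] on its left, the
    path meets next the first edge out of [q_vert q] found when turning
    clockwise from [q_face q]; [heading q] is the direction of that edge. *)
Definition heading (q : qpoint) : vertex :=
  match odd `|q.1|, odd `|q.2| with
  | false, false => right
  | false, true => - up
  | true, true => - right
  | true, false => up
  end.

Definition ahead (q : qpoint) : edge :=
  match odd `|q.1|, odd `|q.2| with
  | false, false => (q_vert q, false)
  | false, true => (q_vert q - up, true)
  | true, true => (q_vert q - right, false)
  | true, false => (q_vert q, true)
  end.

Definition clockwise (u : vertex) : vertex := (u.2, - u.1).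

(** The path follows the edges of [S], and crosses the edges not in [S] (it
    follows then the dual edge). *)
Definition explore (S : {fset edge}) (q : qpoint) : qpoint :=
  if ahead q \in S then q + heading q else q + clockwise (heading q).

(** The contour of [S] seen from [q0], up to and including its first return to
    [q0]; [N] bounds the number of steps. *)
Definition contour (N : nat) (S : {fset edge}) (q0 : qpoint) : seq qpoint :=
  let s := traject (explore S) (explore S q0) N in
  q0 :: take (index q0 s).+1 s.

(** The wired boundary, which consists of the boundary of the domain and of the
    curve [c], is part of what the exploration follows.  A union of faces [F]
    contains [4 * #|F|] points of the lattice of the exploration.  The annulus
    without cut is the case [c = [::]]. *)
Definition exploration (F : {fset face}) (c : seq vertex) (q0 : qpoint)
    (T : {fset edge}) : seq qpoint :=
  contour (4 * #|` F|) (T `|` bd_edges F `|` curve_edges (edges F) c) q0.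

Definition ust_prob (R : realType) (F : {fset face}) (c : seq vertex)
    (ev : pred {fset edge}) : R :=
  uniform_prob R
    (wired_trees (verts F) (edges F) (bd_verts F `|` curve_verts c)) ev.

(** The [eps]-neighbourhood of [c] is discretized as the union of the faces at
    distance at most [eps] of [c]; this distance is attained at vertices. *)
Definition near (R : realType) (delta eps : R) (c : seq vertex)
    (q : qpoint) : bool :=
  has (fun v => has (fun u => dist delta v u <= eps) c) (corners (q_face q)).

(** The path [s] up to and including its first point in [B]. *)
Definition until (B : pred qpoint) (s : seq qpoint) : seq qpoint :=
  take (find B s).+1 s.

(** * Harmonic extension *)

(** The Neumann boundary is recorded by the edges linking it to the interior. *)
Record domain : Type := Domain {
  dom_verts : {fset vertex};
  dom_edges : {fset edge};
  dirichlet : {fset vertex};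
  neumann : {fset edge}
}.

Definition annulus_domain (F : {fset face}) : domain :=
  Domain (verts F) (edges F) (bd_verts F) fset0.

Definition right_verts (gamma : seq qpoint) : {fset vertex} :=
  [fset q_vert q | q in gamma].

(** The left side of [gamma] is made of dual edges; the edges linking it to the
    unexplored domain are those crossed by [gamma]. *)
Definition crossed_edges (gamma : seq qpoint) : {fset edge} :=
  [fset ahead st.1 | st in zip gamma (behead gamma)
                   & q_vert st.1 == q_vert st.2].

Definition slit_domain (F : {fset face}) (gamma : seq qpoint) : domain :=
  Domain (verts F) (edges F) (bd_verts F `|` right_verts gamma)
         (crossed_edges gamma).

Section Harmonic.
Variables (R : realType) (D : domain).

Definition increment (h : vertex -> R) (e : edge) (v w : vertex) : R :=
  if e \in neumann D then 0 else h w - h v.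

Definition laplacian (h : vertex -> R) (v : vertex) : R :=
  \sum_(e <- dom_edges D)
    if (ends e).1 == v then increment h e v (ends e).2
    else if (ends e).2 == v then increment h e v (ends e).1 else 0.

(** At the ends of a cut, which lie on the Dirichlet boundary, the value 0
    prevails. *)
Definition harmonic_extension (alpha : {fset vertex}) (f : {ffun alpha -> R})
    (h : vertex -> R) : Prop :=
  [/\ forall v, v \in dirichlet D -> h v = 0,
      forall x : alpha, val x \notin dirichlet D -> h (val x) = f x
    & forall v, v \in dom_verts D -> v \notin dirichlet D -> v \notin alpha ->
        laplacian h v = 0].

Definition harm (alpha beta : {fset vertex}) (f : {ffun alpha -> R}) :
    {ffun beta -> R} :=
  let h := xget (fun=> 0) (harmonic_extension f) in
  [ffun x : beta => h (val x)].

End Harmonic.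

(** Determinant of an operator on functions on a finite set. *)
Definition op_det (R : realType) (I : finType)
    (L : {ffun I -> R} -> {ffun I -> R}) : R :=
  \det (\matrix_(i < #|I|, j < #|I|)
          L [ffun x => (x == enum_val j)%:R] (enum_val i)).

(** [det (Id - H^{c -> d} o H^{d -> c})] in the domain [D]. *)
Definition det_harm (R : realType) (D : domain) (c d : {fset vertex}) : R :=
  op_det (fun f : {ffun d -> R} => f - harm D d (harm D c f)).

(* Main.v *)
(* By the matrix-tree theorem, the number of wired spanning trees is the
   determinant of the Dirichlet Laplacian.  Prescribing an initial segment
   [gamma] of the exploration amounts to contracting the edges followed by
   [gamma] and deleting those it crosses, so both probabilities are quotients of
   determinants of Laplacians.  On the other hand, block elimination shows that
     det (Id - H^{c -> d} o H^{d -> c}) = Z Z(c, d) / (Z(c) Z(d)),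
   where Z(s) is the determinant of the Laplacian with additional Dirichlet
   conditions on s.  Once d is wired, [gamma] and c do not interact, so that
   Z(c, d) / Z(d) is the same with and without [gamma], and cancels. *)

Require Import Defs.
From mathcomp Require Import all_boot all_order all_algebra finmap.
From mathcomp Require Import boolp classical_sets reals.
From mathcomp Require Import ring zify.

Set Implicit Arguments.
Unset Strict Implicit.
Unset Printing Implicit Defensive.

Import Order.TTheory GRing.Theory Num.Theory.
Local Open Scope fset_scope.
Local Open Scope ring_scope.

(** * Determinants *)

(** All Laplacians are matrices over one index set, the vertices of the domain, with identity rows
    at Dirichlet vertices, so determinants for different boundary conditions are compared without
    reindexing. Likewise [merged U T] lives on the whole lattice and wiring is a shrinking of [U],
    which turns deletion-contraction into an induction without quotient graphs. The obstacle is
    nondegeneracy: [harm] is defined by choice and obeys linear algebra only where the Dirichlet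
    problem is well posed. One tree settles all the cases. A tree witnessing the positive
    probability in the cut domain, completed by the edges of the cut, spans the annulus without the
    crossed edges; wiring more vertices or restoring edges preserves spanning, so the counts to
    divide by are positive. Two points refine the contraction of followed edges. Boundary edges are
    followed whatever the tree is, so only the other followed edges are prescribed. A path stopped
    near the cut inspects no edge meeting the cut, so it prescribes the same edges in both
    domains. *)

Section LinearAlgebra.
Variable R : fieldType.

Lemma det_1DmulC m n (A : 'M[R]_(m, n)) (B : 'M[R]_(n, m)) :
  \det (1%:M + A *m B) = \det (1%:M + B *m A).
Proof.
have e1 : block_mx (1%:M + A *m B) A 0 1%:M *m block_mx 1%:M 0 (- B) 1%:M
        = block_mx 1%:M A (- B) (1%:M : 'M[R]_n).
  rewrite mulmx_block !mulmx1 !mul0mx !mul1mx mulmx0 !add0r.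
  by rewrite mulmxN addrK.
have e2 : block_mx 1%:M 0 (- B) 1%:M *m block_mx 1%:M A 0 (1%:M + B *m A)
        = block_mx (1%:M : 'M[R]_m) A (- B) (1%:M : 'M[R]_n).
  rewrite mulmx_block !mulmx1 !mul0mx !mul1mx !addr0.
  by rewrite mulNmx addrCA [- _ + _]addrC subrr addr0.
have := congr1 determinant (etrans e1 (esym e2)).
by rewrite !det_mulmx det_ublock !det_lblock det_ublock !det1 !mulr1 !mul1r.
Qed.

Lemma det_1BmulC m n (A : 'M[R]_(m, n)) (B : 'M[R]_(n, m)) :
  \det (1%:M - A *m B) = \det (1%:M - B *m A).
Proof. by rewrite -mulmxN det_1DmulC mulNmx. Qed.

Ltac mx_expand :=
  rewrite !(mulmxDl, mulmxDr, mulmxBl, mulmxBr, mulNmx, mulmxN, mulmx1, mul1mx, mulmxA).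
Ltac mx_abel :=
  repeat match goal with |- context [?a *m ?b] => move: (a *m b) => ? end;
  apply/matrixP => ? ?; rewrite !mxE; ring.

(** For a coordinate projection, the rows off [P] are identity rows, so only the [P] block of [X]
    counts. The rest splits off as the factor [1 + P X (1 - P)], of determinant 1 because
    [(1 - P) P = 0]. *)
Lemma det_1D_proj n (P X : 'M[R]_n) : P *m P = P ->
  \det (1%:M - P + P *m X) = \det (1%:M - P + P *m X *m P).
Proof.
move=> PP; set Z := 1%:M - P + P *m X *m P.
have -> : 1%:M - P + P *m X = (1%:M + (P *m X) *m (1%:M - P)) *m Z.
  by rewrite /Z; mx_expand; rewrite -!(mulmxA _ P P) PP; mx_abel.
rewrite det_mulmx det_1DmulC mulmxA mulmxBl mul1mx PP subrr mul0mx addr0.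
by rewrite det1 mul1r.
Qed.

(* [clamp P M] replaces the rows of [M] selected by [P] by those of the
   identity, which is how Dirichlet conditions are imposed. *)
Definition clamp n (P M : 'M[R]_n) := (1%:M - P) *m M + P.

(** Block elimination in projector form. [invmx MP *m P] sends data on [P] to the solution of
    [M u = 0] off [P], so the first determinant involves a round trip from [P] to [Q] and back. Both
    [MQ *m invmx MPQ] and [M *m invmx MP] have identity rows off [P], and [K] relates their [P]
    blocks. *)
Lemma det_clamp2 n (M P Q : 'M[R]_n) :
  P *m P = P -> P *m Q = 0 -> Q *m P = 0 ->
  let MP := clamp P M in let MQ := clamp Q M in let MPQ := clamp (P + Q) M in
  MP \in unitmx -> MQ \in unitmx -> MPQ \in unitmx ->
  \det (1%:M - P *m invmx MQ *m Q *m invmx MP *m P) * \det MP * \det MQ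
  = \det M * \det MPQ.
Proof.
move=> PP PQ QP MP MQ MPQ uP uQ uPQ.
set K := 1%:M - _.
have PK : P *m K = P - P *m invmx MQ *m Q *m invmx MP *m P.
  by rewrite /K; mx_expand; rewrite PP.
have qK : (1%:M - P) *m K = 1%:M - P.
  by rewrite mulmxBl PK mul1mx /K; mx_abel.
have pQ : P *m MQ = P *m M.
  by rewrite /MQ /clamp; mx_expand; rewrite PQ mul0mx subr0 addr0.
have eQ : MPQ = (1%:M - P) *m MQ + P.
  by rewrite /MPQ /MQ /clamp; mx_expand; rewrite PQ mul0mx; mx_abel.
have eP : MPQ = (1%:M - Q) *m MP + Q.
  by rewrite /MPQ /MP /clamp; mx_expand; rewrite QP mul0mx; mx_abel.
have qP : (1%:M - P) *m MP = (1%:M - P) *m M.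
  by rewrite /MP /clamp; mx_expand; rewrite PP; mx_abel.
have qQ : (1%:M - P) *m MQ = (1%:M - P) *m MPQ.
  by rewrite eQ; mx_expand; rewrite PP; mx_abel.
clearbody K; clearbody MP MQ MPQ.
(* Take the extension of data on [P] and subtract the extension of its trace on [Q]: the result
   vanishes on [Q] and equals [K] times the data on [P], so by uniqueness it is the extension from
   [P] with zero on [Q]. *)
have key : invmx MPQ *m P *m K = invmx MP *m P - invmx MQ *m Q *m invmx MP *m P.
  apply: (can_inj (mulKmx uPQ)); rewrite -mulmxA mulKVmx // PK mulmxBr.
  rewrite {1}eP eQ; mx_expand; rewrite -!(mulmxA _ MP (invmx MP)) -!(mulmxA _ MQ (invmx MQ)).
  rewrite !mulmxV //; mx_expand; rewrite QP PQ !mul0mx; mx_abel.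
have dX : \det (MQ *m invmx MPQ) * \det K = \det (M *m invmx MP).
  have -> : MQ *m invmx MPQ = 1%:M - P + P *m (MQ *m invmx MPQ).
    by rewrite -[X in X + _](mulmxK uPQ) -qQ; mx_expand; mx_abel.
  have -> : M *m invmx MP = 1%:M - P + P *m (M *m invmx MP).
    by rewrite -[X in X + _](mulmxK uP) qP; mx_expand; mx_abel.
  rewrite !det_1D_proj // -det_mulmx; congr (\det _).
  rewrite mulmxDl qK; congr (_ + _).
  have -> : P *m (MQ *m invmx MPQ) *m P *m K = P *m MQ *m (invmx MPQ *m P *m K).
    by rewrite !mulmxA.
  rewrite key mulmxBr !mulmxA.
  by rewrite -(mulmxA P MQ (invmx MQ)) mulmxV // mulmx1 PQ !mul0mx subr0 pQ.
have dP : \det MP != 0 by rewrite -unitfE.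
have dPQ : \det MPQ != 0 by rewrite -unitfE.
move: dX; rewrite !det_mulmx !det_inv => dX.
transitivity (\det MQ / \det MPQ * \det K * \det MP * \det MPQ).
  by field.
by rewrite dX; field.
Qed.

(** Block triangularity makes the product of the two clamped matrices equal to [M] itself. *)
Lemma det_clamp_block n (P M : 'M[R]_n) :
  P *m P = P -> (1%:M - P) *m M *m P = 0 ->
  \det M = \det (clamp P M) * \det (clamp (1%:M - P) M).
Proof.
move=> PP ME0; rewrite -det_mulmx; congr (\det _).
rewrite /clamp; have -> : 1%:M - (1%:M - P) = P by rewrite opprB addrC subrK.
have e1 : (1%:M - P) *m M *m (P *m M + (1%:M - P)) = (1%:M - P) *m M.
  by rewrite mulmxDr mulmxA ME0 mul0mx add0r mulmxBr ME0 mulmx1 subr0.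
have e2 : P *m (P *m M + (1%:M - P)) = P *m M.
  by rewrite mulmxDr mulmxA PP mulmxBr PP mulmx1 subrr addr0.
by rewrite (mulmxDl _ P) e1 e2 mulmxBl mul1mx subrK.
Qed.

End LinearAlgebra.

(** * Forests and contraction *)

(* [merged U T] identifies the vertices outside [U] with each other, and the
   ends of each edge of [T]; it does not mention the quotient types, so that
   [U] can vary. *)
Inductive merged (U : {fset vertex}) (T : {fset edge}) : vertex -> vertex -> Prop :=
| merged_refl x : merged U T x x
| merged_out x y : x \notin U -> y \notin U -> merged U T x y
| merged_edge e : e \in T -> merged U T (ends e).1 (ends e).2
| merged_sym x y : merged U T x y -> merged U T y x
| merged_trans y x z : merged U T x y -> merged U T y z -> merged U T x z.

Definition spans (U : {fset vertex}) (T : {fset edge}) :=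
  forall x y, merged U T x y.

Definition forest (U : {fset vertex}) (T : {fset edge}) :=
  forall e, e \in T -> ~ merged U (T `\ e) (ends e).1 (ends e).2.

Definition tree (U : {fset vertex}) (T : {fset edge}) := spans U T /\ forest U T.

Lemma merged_sub (U U' : {fset vertex}) (T T' : {fset edge}) x y :
  (forall x y, x \notin U -> y \notin U -> merged U' T' x y) ->
  (forall e, e \in T -> merged U' T' (ends e).1 (ends e).2) ->
  merged U T x y -> merged U' T' x y.
Proof.
move=> Ho Ht; elim => {x y} [x|x y|e|x y _|y x z _ + _].
- exact: merged_refl.
- exact: Ho.
- exact: Ht.
- exact: merged_sym.
- exact: merged_trans.
Qed.

Lemma merged_mono (U U' : {fset vertex}) (T T' : {fset edge}) x y :
  U' `<=` U -> T `<=` T' -> merged U T x y -> merged U' T' x y.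
Proof.
move=> /fsubsetP sU /fsubsetP sT; apply: merged_sub => [u v uU vU|e eT].
  by apply: merged_out; [apply: contra uU|apply: contra vU]; exact: sU.
by apply: merged_edge; exact: sT.
Qed.

(** The hypothesis, reused below, says that contracting [Q] has the effect of the wiring encoded by
    [U']. This occurs when the edges of [Q] are all linked to the wired class through [Q]. *)
Lemma merged_contract (U U' : {fset vertex}) (Q T : {fset edge}) :
  (forall x y, merged U' fset0 x y <-> merged U Q x y) ->
  forall x y, merged U' T x y <-> merged U (Q `|` T) x y.
Proof.
move=> UQ x y; split; apply: merged_sub => [u v uU vU|e].
- apply: (@merged_mono U _ Q); rewrite ?fsubsetUl //.
  by apply/UQ; exact: merged_out.
- by move=> eT; apply: merged_edge; rewrite inE eT orbT.
- apply: (@merged_mono U' _ fset0); rewrite ?fsub0set //.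
  by apply/UQ; exact: merged_out.
- rewrite inE => /orP[eQ|]; last exact: merged_edge.
  apply: (@merged_mono U' _ fset0); rewrite ?fsub0set //.
  by apply/UQ; exact: merged_edge.
Qed.

Lemma merged_fset1U U T e x y : merged U (e |` T) x y ->
  [\/ merged U T x y,
      merged U T x (ends e).1 /\ merged U T (ends e).2 y |
      merged U T x (ends e).2 /\ merged U T (ends e).1 y].
Proof.
have tr := @merged_trans U T; have sy := @merged_sym U T.
elim => {x y} [x|x y xU yU|f|x y _ [|[]|[]]|y x z _ Hx _ Hz].
- by apply: Or31; exact: merged_refl.
- by apply: Or31; exact: merged_out.
- rewrite in_fset1U => /orP[/eqP ->|fT]; last by apply: Or31; exact: merged_edge.
  by apply: Or32; split; exact: merged_refl.
- by move=> /sy; apply: Or31.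
- by move=> /sy h1 /sy h2; apply: Or33.
- by move=> /sy h1 /sy h2; apply: Or32.
- case: Hx => [h1|[h1 h2]|[h1 h2]]; case: Hz => [h3|[h3 h4]|[h3 h4]].
  + by apply: Or31; apply: tr h1 h3.
  + by apply: Or32; split=> //; apply: tr h1 h3.
  + by apply: Or33; split=> //; apply: tr h1 h3.
  + by apply: Or32; split=> //; apply: tr h2 h3.
  + by apply: Or32; split.
  + by apply: Or31; apply: tr h1 h4.
  + by apply: Or33; split=> //; apply: tr h2 h3.
  + by apply: Or31; apply: tr h1 h4.
  + by apply: Or33; split.
Qed.

Lemma forest_loop U T e : forest U T -> merged U fset0 (ends e).1 (ends e).2 ->
  e \notin T.
Proof.
move=> fT le; apply/negP => /fT; apply.
by apply: merged_mono le; rewrite ?fsub0set.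
Qed.

Lemma forest_sub U (T T' : {fset edge}) : T' `<=` T -> forest U T -> forest U T'.
Proof.
move=> sT fT e eT' h; apply: (fT e); first exact: (fsubsetP sT).
by apply: merged_mono h => //; exact: fsetSD.
Qed.

Lemma forest_fsetU U U' (Q T : {fset edge}) : [disjoint Q & T] ->
  (forall x y, merged U' fset0 x y <-> merged U Q x y) -> forest U Q ->
  (forest U (Q `|` T) <-> forest U' T).
Proof.
move=> dQT UQ fQ.
have nQ e : e \in T -> e \notin Q.
  by move=> eT; apply/negP => eQ; move/fdisjointP: dQT => /(_ _ eQ); rewrite eT.
have QTe e : e \in T -> (Q `|` T) `\ e = Q `|` (T `\ e).
  move=> eT; apply/fsetP => f; rewrite !inE.
  by case: (f =P e) => [->|//] /=; rewrite (negbTE (nQ _ eT)).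
split=> [fQT e eT|fT e].
  by rewrite (merged_contract _ UQ) -QTe //; apply: fQT; rewrite inE eT orbT.
rewrite inE; case/boolP: (e \in T) => [eT _|neT].
  by rewrite QTe // -(merged_contract _ UQ); exact: fT.
rewrite orbF => eQ.
(* Otherwise, adding the edges of [T] to [Q] one at a time, one of them
   closes a cycle after contraction of [Q]. *)
suff H (S : {fset edge}) : S `<=` T ->
    ~ merged U ((Q `|` S) `\ e) (ends e).1 (ends e).2 by exact: H.
elim/finSet_rect: S => S IH ST.
have [->|[f fS]] := fset_0Vmem S; first by rewrite fsetU0; exact: fQ.
have fT' := fsubsetP ST _ fS.
have fe : f != e by apply: contraNneq (nQ _ fT') => ->.
have -> : (Q `|` S) `\ e = f |` ((Q `|` (S `\ f)) `\ e).
  apply/fsetP => g; rewrite !inE.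
  by case: (g =P f) => [->|] //=; rewrite fe fS orbT.
have sS : S `\ f `<` S by rewrite fproperD1.
have {IH} IH := IH _ sS (fsubset_trans (fsubsetDl _ _) ST).
have up x y : merged U ((Q `|` (S `\ f)) `\ e) x y -> merged U' (T `\ f) x y.
  move=> h; apply/(merged_contract (T `\ f) UQ); apply: merged_mono h => //.
  rewrite (fsubset_trans (fsubsetDl _ _)) //; apply: fsetUS; exact: fsetSD.
(* As [e] is in [Q], its ends coincide after contraction, so a cycle through [e] and [f] would join
   the ends of [f] by other edges of [T]. *)
have ee : merged U' (T `\ f) (ends e).1 (ends e).2.
  by apply/(merged_contract _ UQ); apply: merged_edge; rewrite inE eQ.
move/merged_fset1U => [//|[/up h1 /up h2]|[/up h1 /up h2]]; apply: (fT f fT').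
  apply: merged_trans (merged_sym h1) _; apply: merged_trans ee (merged_sym h2).
apply: merged_trans h2 _; apply: merged_trans (merged_sym ee) h1.
Qed.

Lemma tree_fsetU U U' (Q T : {fset edge}) : [disjoint Q & T] ->
  (forall x y, merged U' fset0 x y <-> merged U Q x y) -> forest U Q ->
  (tree U (Q `|` T) <-> tree U' T).
Proof.
move=> dQT UQ fQ; split=> -[sT fT]; split.
- by move=> x y; apply/(merged_contract _ UQ).
- by apply/(forest_fsetU dQT UQ fQ).
- by move=> x y; apply/(merged_contract _ UQ).
- by apply/(forest_fsetU dQT UQ fQ).
Qed.

Lemma spans_tree U T : spans U T -> exists2 T', T' `<=` T & tree U T'.
Proof.
elim/finSet_rect: T => T IH sT.
have [fT|] := pselect (forest U T); first by exists T.
rewrite /forest => /existsNP[e] /not_implyP[eT] /contrapT ee.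
have pT : T `\ e `<` T by rewrite fproperD1.
have [|T' sT' tT'] := IH _ pT; last first.
  by exists T' => //; exact: fsubset_trans (fproper_sub pT).
move=> x y; apply: merged_sub (sT x y) => [u v|f fT]; first exact: merged_out.
have [->//|fe] := eqVneq f e; apply: merged_edge; by rewrite !inE fe.
Qed.

(** The lattice is infinite, so the wired class is never empty: it always represents the contracted
    vertex [None]. *)
Lemma fresh_vertex (U : {fset vertex}) : exists x, x \notin U.
Proof.
pose n := (\max_(v <- U) `|v.1|)%N.
exists (n.+1%:Z, 0); apply/negP => h.
have : (`|(n.+1%:Z, 0 : int).1| <= n)%N.
  by exact: (leq_bigmax_seq (F := fun v : vertex => `|v.1|%N)).
by rewrite /= ltnn.
Qed.

(** * Agreement with spanning trees of the contracted graph *)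

Section SpanningTree.
Variables V W : {fset vertex}.
Let U := V `\` W.

Lemma cadj_sym T : symmetric (@cadj V W T).
Proof. by move=> x y; apply: eq_has => e; rewrite orbC. Qed.

Lemma merged_connect (T : {fset edge}) x y : merged U T x y ->
  connect (@cadj V W T) (insub x) (insub y).
Proof.
elim => {x y} [x|x y xU yU|e eT|x y _|y x z _ + _].
- exact: connect0.
- by rewrite !insubN //; exact: connect0.
- by apply: connect1; apply/hasP; exists e => //; rewrite eqxx.
- by rewrite (sym_connect_sym (@cadj_sym T)).
- exact: connect_trans.
Qed.

Lemma connect_merged (T : {fset edge}) x y :
  connect (@cadj V W T) (insub x) (insub y) -> merged U T x y.
Proof.
have insubE u v : insub u = insub v :> option U -> merged U T u v.
  case: insubP => [u' uU ue|uU]; case: insubP => [v' vU ve|vU] //.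
    by move=> [uv]; rewrite -ue -ve uv; exact: merged_refl.
  by move=> _; exact: merged_out.
case/connectP => p; elim: p x => [|p ps IH] x /=; first by move=> _ /esym /insubE.
case/andP => /hasP[e eT] he hp hy.
case/orP: he => /eqP [ex ep].
  apply: merged_trans (insubE _ _ (esym ex)) _.
  apply: (merged_trans (merged_edge _ eT)); apply: IH => //; by rewrite ep.
apply: merged_trans (insubE _ _ (esym ep)) _.
apply: (merged_trans (merged_sym (merged_edge _ eT))); apply: IH => //; by rewrite ex.
Qed.

Lemma spanning_treeP T : reflect (tree U T) (spanning_tree V W T).
Proof.
apply: (iffP andP) => -[sT fT]; split.
- by move=> x y; apply: connect_merged; move/forallP/(_ (insub x))/forallP: sT.
- by move=> e eT /merged_connect h; move/allP/(_ e eT)/negP: fT.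
- apply/forallP => x; apply/forallP => y.
  have insub_ex (z : option U) : exists v, z = insub v.
    case: z => [z|]; first by exists (val z); rewrite valK.
    by have [v vU] := fresh_vertex U; exists v; rewrite insubN.
  have [[u ->] [v ->]] := (insub_ex x, insub_ex y).
  exact/merged_connect/sT.
- by apply/allP => e eT; apply/negP => /connect_merged; exact: fT.
Qed.

End SpanningTree.

Definition trees (U : {fset vertex}) (E : {fset edge}) : {fset {fset edge}} :=
  [fset T in fpowerset E | `[< tree U T >]].

Lemma in_trees U E T : reflect (T `<=` E /\ tree U T) (T \in trees U E).
Proof.
rewrite !inE /= fpowersetE.
by apply: (iffP andP) => -[TE tT]; split=> //; apply/asboolP.
Qed.

Lemma wired_treesE V E W : wired_trees V E W = trees (V `\` W) E.
Proof.
apply/fsetP => T; rewrite !inE /=; congr (_ && _).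
by apply/spanning_treeP/asboolP.
Qed.

Lemma trees_gt0 (U : {fset vertex}) (E : {fset edge}) :
  spans U E -> (0 < #|` trees U E|)%N.
Proof.
move=> /spans_tree[T TE tT]; rewrite cardfs_gt0; apply/fset0Pn; exists T.
exact/in_trees.
Qed.

(** The bijection adds [Q] to a tree of the contraction. Such a tree contains no edge of [Q], since
    these have become loops, so removing [Q] inverts it. *)
Lemma card_trees_contract (U U' : {fset vertex}) (E Q P : {fset edge}) :
  (forall x y, merged U' fset0 x y <-> merged U Q x y) -> forest U Q ->
  Q `<=` E -> [disjoint Q & P] ->
  #|` [fset T in trees U E | (Q `<=` T) && fdisjoint T P]|
  = #|` trees U' (E `\` P)|.
Proof.
move=> UQ fQ QE QP.
have dQ T : T \in trees U' (E `\` P) -> [disjoint Q & T].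
  move/in_trees => [_ [_ fT]]; apply/fdisjointP => e eQ.
  by apply: forest_loop fT _; apply/UQ; exact: merged_edge.
have -> : [fset T in trees U E | (Q `<=` T) && fdisjoint T P]
        = (fun T => Q `|` T) @` trees U' (E `\` P).
  apply/fsetP => T; apply/idP/imfsetP => /= [|[T' T't ->]].
    rewrite !inE /= -andbA => /andP[TE /and3P[/asboolP tT QT TP]].
    have TQ : Q `|` (T `\` Q) = T.
      apply/fsetP => e; rewrite !inE.
      by case/boolP: (e \in Q) => [/(fsubsetP QT) ->|].
    exists (T `\` Q); last by [].
    apply/in_trees; split.
      apply/fsubsetP => e; rewrite !inE => /andP[eQ eT].
      rewrite (fdisjointP TP _ eT) /=; move: TE; rewrite fpowersetE.
      by move/fsubsetP; apply.
    by apply/(tree_fsetU _ UQ fQ); rewrite ?TQ //; apply/fdisjointP => e eQ; rewrite inE eQ.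
  have /in_trees[T'E tT'] := T't.
  rewrite !inE /= fpowersetE fsubsetUl /= fdisjointUX QP /= fsubUset QE /=.
  rewrite (fsubset_trans T'E) ?fsubsetDl //=; apply/andP; split.
    by apply/asboolP/(tree_fsetU _ UQ fQ) => //; exact: dQ.
  by apply/fdisjointP => e /(fsubsetP T'E); rewrite inE => /andP[].
apply/eqP/card_in_imfsetP => T1 T2 /dQ d1 /dQ d2 /(congr1 (fun T => T `\` Q)).
rewrite !fsetDUl fsetDv !fset0U.
have dE T : [disjoint Q & T] -> T `\` Q = T.
  by rewrite fdisjoint_sym => /fsetDidPl.
by rewrite !dE.
Qed.

(** * The matrix-tree theorem *)

Section Laplacian.
Variable R : fieldType.
Implicit Types (h : vertex -> R) (v w : vertex).

Definition edge_lap h (e : edge) v : R :=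
  if (ends e).1 == v then h (ends e).2 - h v
  else if (ends e).2 == v then h (ends e).1 - h v else 0.

Definition lap (E : {fset edge}) h v : R := \sum_(e <- E) edge_lap h e v.

Definition ind w v : R := (v == w)%:R.

Variable V : {fset vertex}.

Definition vtx (i : 'I_#|{: V}|) : vertex := val (enum_val i).

(** The minus sign makes the determinant a count of trees. A neighbour outside [V] has no column but
    still contributes to the diagonal. *)
Definition lapmx (E : {fset edge}) (U : {fset vertex}) : 'M[R]_#|{: V}| :=
  \matrix_(i, j) if vtx i \in U then - lap E (ind (vtx j)) (vtx i) else (i == j)%:R.

Definition projmx (S : {fset vertex}) : 'M[R]_#|{: V}| :=
  \matrix_(i, j) ((i == j) && (vtx i \in S))%:R.

Lemma vtx_inj : injective vtx.
Proof. by move=> i j /val_inj /enum_val_inj. Qed.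

Lemma vtx_in i : vtx i \in V.
Proof. exact: valP. Qed.

Lemma vtxP v : v \in V -> exists i, vtx i = v.
Proof. by move=> vV; exists (enum_rank [` vV]); rewrite /vtx enum_rankK. Qed.

Lemma projmxM n S (N : 'M[R]_(_, n)) i j :
  (projmx S *m N) i j = if vtx i \in S then N i j else 0.
Proof.
rewrite mxE (bigD1 i) //= big1 => [|k ki]; last first.
  by rewrite mxE eq_sym (negbTE ki) mul0r.
by rewrite mxE eqxx addr0 /=; case: ifP; rewrite ?mul1r ?mul0r.
Qed.

Lemma mul_projmx n S (N : 'M[R]_(n, _)) i j :
  (N *m projmx S) i j = if vtx j \in S then N i j else 0.
Proof.
rewrite mxE (bigD1 j) //= big1 => [|k ki]; last first.
  by rewrite mxE (negbTE ki) mulr0.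
by rewrite mxE eqxx addr0 /=; case: ifP; rewrite ?mulr1 ?mulr0.
Qed.

Lemma projmxI S S' : projmx S *m projmx S' = projmx (S `&` S').
Proof.
apply/matrixP => i j; rewrite projmxM !mxE inE.
by case: (_ \in S); rewrite ?andbF.
Qed.

Lemma projmx_id S : projmx S *m projmx S = projmx S.
Proof. by rewrite projmxI fsetIid. Qed.

Lemma projmxU S S' : [disjoint S & S'] ->
  projmx S + projmx S' = projmx (S `|` S').
Proof.
move=> /fdisjointP dS; apply/matrixP => i j; rewrite !mxE inE.
case: eqP => //= _; last by rewrite addr0.
have := dS (vtx i); case: (_ \in S) => [/(_ isT)/negbTE ->|_]; by rewrite ?addr0 ?add0r.
Qed.

Lemma clamp_lapmx E U S : clamp (projmx S) (lapmx E U) = lapmx E (U `\` S).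
Proof.
apply/matrixP => i j; rewrite /clamp mulmxBl mul1mx.
rewrite mxE [X in X + _]mxE [X in _ + X + _]mxE projmxM !mxE !inE.
case: (vtx i \in S) => /=; rewrite ?subrr ?add0r ?andbT //.
by rewrite subr0 andbF addr0.
Qed.

Lemma edge_lap_notin h e v : (ends e).1 != v -> (ends e).2 != v ->
  edge_lap h e v = 0.
Proof. by rewrite /edge_lap => /negbTE -> /negbTE ->. Qed.

Lemma lapD1 E e h v : e \in E -> lap E h v = edge_lap h e v + lap (E `\ e) h v.
Proof. by move=> eE; rewrite /lap (big_fsetD1 e). Qed.

Lemma lap_fsetD E P h v :
  (forall e, e \in P -> (ends e).1 != v /\ (ends e).2 != v) ->
  lap (E `\` P) h v = lap E h v.
Proof.
move=> HP; apply: big_fset_incl => [|e eE]; first exact: fsubsetDl.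
rewrite !inE eE andbT negbK => /HP[]; exact: edge_lap_notin.
Qed.

(** Deletion-contraction by linearity in the row of [x], the only row of [U] that involves [e].
    There [e] contributes the indicator of [x], which clamps the row, minus that of [o]. *)
Lemma det_lapmx_crossing E U e x o : U `<=` V -> e \in E -> x \in U -> o \notin U ->
  ends e = (x, o) \/ ends e = (o, x) ->
  \det (lapmx E U) = \det (lapmx (E `\ e) U) + \det (lapmx E (U `\ x)).
Proof.
move=> UV eE xU oU He.
have xo : x != o by apply: contraNneq oU => <-.
have [ix ixx] := vtxP (fsubsetP UV _ xU).
have elx h : edge_lap h e x = h o - h x.
  rewrite /edge_lap; case: He => -> /=; rewrite eqxx //.
  by rewrite eq_sym (negbTE xo).
have el v h : v \in U -> v != x -> edge_lap h e v = 0.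
  move=> vU vx; have vo : v != o by apply: contraTneq vU => ->.
  by apply: edge_lap_notin; case: He => -> /=; rewrite eq_sym.
pose row_at (f : 'I_#|{: V}| -> R) : 'M[R]_#|{: V}| :=
  \matrix_(i, j) if i == ix then f j else lapmx E U i j.
have row_atE f i j : i != ix -> row_at f i j = lapmx E U i j.
  by rewrite /row_at mxE => /negbTE ->.
have row'E f : row' ix (row_at f) = row' ix (lapmx E U).
  by apply/matrixP => i j; rewrite [LHS]mxE [RHS]mxE row_atE // eq_sym neq_lift.
pose A := row_at (fun j => ind (vtx j) x - ind (vtx j) o).
have -> : \det (lapmx E U) = 1 * \det (lapmx (E `\ e) U) + 1 * \det A.
  apply: (@determinant_multilinear _ _ _ _ _ ix) => //.
  - apply/rowP => j; rewrite !mxE ixx xU eqxx (lapD1 _ _ eE) elx; ring.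
  - apply/matrixP => i j; rewrite !mxE; case: ifP => // iU.
    rewrite (lapD1 _ _ eE) el ?add0r // -ixx (inj_eq vtx_inj).
    by rewrite eq_sym neq_lift.
  - exact: row'E.
have -> : \det A = 1 * \det (lapmx E (U `\ x)) + (-1) * \det (row_at (fun j => ind (vtx j) o)).
  apply: (@determinant_multilinear _ _ _ _ _ ix); rewrite ?row'E //.
    apply/rowP => j; rewrite !mxE ixx eqxx !inE eqxx /= -ixx /ind (inj_eq vtx_inj); ring.
  apply/matrixP => i j; rewrite !mxE !inE -ixx (inj_eq vtx_inj).
  by rewrite eq_sym neq_lift.
(* If [o] is in [V], its own row is an identity row, now repeated at [ix]; otherwise the row at [ix]
   is zero. *)
have -> : \det (row_at (fun j => ind (vtx j) o)) = 0.
  have [/vtxP[io ioo]|oV] := boolP (o \in V).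
    have ixo : ix != io by apply: contraNneq xo => ixo; rewrite -ixx -ioo ixo.
    apply: (determinant_alternate ixo) => j; rewrite !mxE eqxx eq_sym (negbTE ixo).
    by rewrite ioo (negbTE oU) /ind -ioo (inj_eq vtx_inj).
  rewrite (expand_det_row _ ix) big1 // => j _; rewrite mxE eqxx /ind.
  by rewrite (negPf (_ : o != vtx j)) ?mul0r //; apply: contraNneq oV => ->; exact: vtx_in.
ring.
Qed.

(** Trees are sorted by whether they contain [e]. Since [o] is already wired, contracting [e] just
    wires [x]. *)
Lemma card_trees_crossing E U e x o : e \in E -> x \in U -> o \notin U ->
  ends e = (x, o) \/ ends e = (o, x) ->
  #|` trees U E| = (#|` trees U (E `\ e)| + #|` trees (U `\ x) E|)%N.
Proof.
move=> eE xU oU He.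
have xo : x != o by apply: contraNneq oU => <-.
have eM (S : {fset edge}) : e \in S -> merged U S x o.
  by move=> /(merged_edge U); case: He => -> // /merged_sym.
have UQ y z : merged (U `\ x) fset0 y z <-> merged U [fset e] y z.
  split; apply: merged_sub => [u v|f]; rewrite ?inE //.
    have out w : ~~ ((w != x) && (w \in U)) -> merged U [fset e] w o.
      rewrite negb_and negbK => /orP[/eqP ->|wU]; last exact: merged_out.
      by apply: eM; rewrite inE.
    by move=> /out h1 /out h2; apply: merged_trans h1 (merged_sym h2).
    by move=> uU vU; apply: merged_out; rewrite !inE (negPf uU, negPf vU) andbF.
  move=> /eqP ->; apply: merged_out; case: He => -> /=;
    by rewrite !inE ?eqxx // (negPf oU) andbF.
have fQ : forest U [fset e].
  move=> f; rewrite inE => /eqP -> ; rewrite fsetDv => h.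
  have stuck y z : merged U fset0 y z -> (y == x) = (z == x).
    elim => {y z} [//|y z yU zU|//|y z _ ->//|y w z _ -> _ -> //].
    have ne w : w \notin U -> (w == x) = false.
      by move=> wU; apply/eqP => wx; rewrite wx xU in wU.
    by rewrite !ne.
  by case: He h => -> /= /stuck; rewrite eqxx eq_sym (negPf xo).
have := @card_trees_contract U (U `\ x) E [fset e] fset0 UQ fQ.
rewrite fdisjointX0 fsub1set fsetD0 => /(_ eE isT) <-.
rewrite -(cardfsID [fset T in trees U E | e \in T]) addnC; congr (_ + _)%N.
  congr #|` _|; apply/fsetP => T; apply/fsetDP/in_trees.
    move=> [/in_trees[TE tT]]; rewrite !inE /= => nT; split=> //.
    rewrite fsubsetD1 TE; apply/negP => eT; move: nT; rewrite eT andbT.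
    have : T \in trees U E by exact/in_trees.
    by rewrite !inE /= => ->.
  rewrite fsubsetD1 => -[/andP[TE eT] tT]; split; first exact/in_trees.
  by rewrite !inE /= (negPf eT) andbF.
congr #|` _|; apply/fsetP => T; rewrite !inE /= fsub1set fdisjointX0 andbT.
by rewrite andbA andbb.
Qed.

(** Both sides obey the same recursion at an edge leaving [U]. If there is none, either [U] is empty
    and both sides are 1, or both are 0: no edge set reaches the wired class from [U], and the
    indicator of [U] is in the kernel. *)
Theorem matrix_tree E U : U `<=` V -> \det (lapmx E U) = #|` trees U E|%:R.
Proof.
have [n] := ubnP (#|` U| + #|` E|)%N; elim: n => // n IH in E U * => nUE UV.
have [[e [x [o [eE xU oU He]]]]|Hno] := pselect (exists e x o, 
    [/\ e \in E, x \in U, o \notin U & ends e = (x, o) \/ ends e = (o, x)]).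
  rewrite (det_lapmx_crossing UV eE xU oU He) (card_trees_crossing eE xU oU He).
  rewrite natrD !IH //.
  - by move: nUE; rewrite [#|` U|](cardfsD1 x) xU; lia.
  - by rewrite (fsubset_trans _ UV) // fsubsetDl.
  - by move: nUE; rewrite [#|` E|](cardfsD1 e) eE; lia.
have [U0|[x xU]] := fset_0Vmem U.
  have -> : lapmx E U = 1%:M by apply/matrixP => i j; rewrite !mxE U0 inE.
  rewrite det1; suff -> : trees U E = [fset fset0] by rewrite cardfs1.
  have mg T y z : merged U T y z by apply: merged_out; rewrite U0 inE.
  apply/fsetP => T; rewrite inE; apply/in_trees/eqP => [[_ [_ fT]]|->].
    by apply/fsetP => e; rewrite inE; apply/negP => eT; apply: (fT e eT).
  by split; [exact: fsub0set|split=> [y z|e]; rewrite ?inE].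
have -> : trees U E = fset0.
  apply/fsetP => T; rewrite inE; apply/negP => /in_trees[/fsubsetP TE [sT _]].
  have [o oU] := fresh_vertex U.
  have H y z : merged U T y z -> (y \in U) = (z \in U).
    elim => {y z} [//|y z /negPf -> /negPf -> //|e eT|y z _ ->//|y w z _ -> _ -> //].
    apply/idP/idP => h; apply/negPn/negP => h'; apply: Hno; exists e.
      by exists (ends e).1, (ends e).2; split; rewrite ?TE //; left; case: (ends e).
    by exists (ends e).2, (ends e).1; split; rewrite ?TE //; right; case: (ends e).
  by move: (H _ _ (sT x o)); rewrite xU (negPf oU).
rewrite cardfs0; apply/eqP; rewrite -det_tr; apply/det0P.
exists (\row_j (vtx j \in U)%:R).
  have [i ix] := vtxP (fsubsetP UV _ xU).
  by apply/eqP => /rowP /(_ i); rewrite !mxE ix xU => /eqP; rewrite oner_eq0.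
apply/rowP => i; rewrite !mxE.
under eq_bigr => j _ do rewrite !mxE.
have [iU|iU] := boolP (vtx i \in U); last first.
  rewrite big1 // => j _; case: eqP => [<-|]; by rewrite ?(negPf iU) ?mul0r ?mulr0.
transitivity (- \sum_(e <- E) \sum_j ((vtx j \in U)%:R * edge_lap (ind (vtx j)) e (vtx i))).
  rewrite exchange_big -sumrN; apply: eq_bigr => j _.
  by rewrite mulrN -mulr_sumr.
have sum1 v : v \in U -> \sum_j ((vtx j \in U)%:R * ind (vtx j) v) = 1.
  move=> vU; have [k kv] := vtxP (fsubsetP UV _ vU).
  rewrite (bigD1 k) //= big1 => [|j jk]; first by rewrite kv vU /ind eqxx mulr1 addr0.
  by rewrite /ind -kv (inj_eq vtx_inj) eq_sym (negPf jk) mulr0.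
rewrite big_seq big1 ?oppr0 // => e eE; rewrite /edge_lap.
have [e1|_] := eqVneq.
  under eq_bigr => j _ do rewrite mulrBr.
  rewrite sumrB !sum1 ?subrr //; apply/negPn/negP => h; apply: Hno.
  by exists e, (vtx i), (ends e).2; split=> //; left; rewrite -e1; case: (ends e).
have [e2|_] := eqVneq; last by rewrite big1 // => j _; rewrite mulr0.
under eq_bigr => j _ do rewrite mulrBr.
rewrite sumrB !sum1 ?subrr //; apply/negPn/negP => h; apply: Hno.
by exists e, (vtx i), (ends e).1; split=> //; right; rewrite -e2; case: (ends e).
Qed.

(** The rows outside [S] vanish in the columns of [S], so the matrix is block triangular. *)
Lemma det_lapmx_split E U S :
  (forall e x y, e \in E -> joins e x y -> x \in S -> y \in U -> y \in S) ->
  \det (lapmx E U) = \det (lapmx E (U `\` S)) * \det (lapmx E (U `&` S)).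
Proof.
move=> HS.
have E1 : 1%:M - projmx S = projmx (V `\` S).
  apply/matrixP => i j; rewrite !mxE inE vtx_in andbT.
  by case: (i == j); case: (_ \in S); rewrite /= ?subrr ?subr0.
rewrite (@det_clamp_block _ _ (projmx S)) ?projmx_id //.
  rewrite clamp_lapmx E1 clamp_lapmx; congr (_ * \det _).
  apply/matrixP => i j; rewrite !mxE !inE vtx_in andbT negbK.
  by rewrite andbC.
rewrite E1; apply/matrixP => i j; rewrite mul_projmx projmxM !mxE inE vtx_in andbT.
case: ifP => // jS; case: ifP => // iS.
case: ifP => iU; last by case: eqP => // ij; rewrite ij jS in iS.
apply/eqP; rewrite oppr_eq0 /lap big_seq big1 // => e eE; rewrite /edge_lap /ind.
have ij : (vtx i == vtx j) = false by apply/eqP => ij; rewrite ij jS in iS.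
rewrite ij !subr0.
have [e1|_] := eqVneq.
  case: eqP => // e2; move: iS; rewrite (HS e (vtx j) (vtx i)) //.
  by rewrite /joins -e1 -e2 -surjective_pairing eqxx orbT.
have [e2|//] := eqVneq.
case: eqP => // e1; move: iS; rewrite (HS e (vtx j) (vtx i)) //.
by rewrite /joins -e1 -e2 -surjective_pairing eqxx.
Qed.

End Laplacian.

(** [S] is the side of the cut. With [d] wired, each determinant is a product over [S] and its
    complement; [C] affects only the first factor, [rv] and [P] only the second, and the same four
    factors occur on both sides. *)
Lemma det_lapmx_decouple (R : realType) (V U S C d rv : {fset vertex}) (E P : {fset edge}) :
  (forall e x y, e \in E -> joins e x y -> x \in S -> y \in U `\` d -> y \in S) ->
  C `<=` S -> [disjoint U `&` rv & S] ->
  (forall e, e \in P -> (ends e).1 \notin S /\ (ends e).2 \notin S) ->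
  \det (lapmx R V E (U `\` (d `|` C))) * \det (lapmx R V (E `\` P) (U `\` rv `\` d))
  = \det (lapmx R V E (U `\` d)) * \det (lapmx R V (E `\` P) (U `\` rv `\` (d `|` C))).
Proof.
move=> HS /fsubsetP CS /fdisjointP rvS PS.
have split (U' : {fset vertex}) (E' : {fset edge}) : E' `<=` E -> U' `<=` U `\` d ->
    \det (lapmx R V E' U') = \det (lapmx R V E' (U' `\` S)) * \det (lapmx R V E' (U' `&` S)).
  move=> /fsubsetP EE /fsubsetP UU; apply: det_lapmx_split => e x y /EE eE exy xS /UU.
  exact: HS exy xS.
have lapP (U' : {fset vertex}) : lapmx R V (E `\` P) (U' `&` S) = lapmx R V E (U' `&` S).
  apply/matrixP => i j; rewrite !mxE inE; case: ifP => // /andP[_ iS].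
  by rewrite lap_fsetD // => e /PS[h1 h2];
    split; [apply: contraNneq h1|apply: contraNneq h2] => ->.
have UC : (U `\` (d `|` C)) `\` S = (U `\` d) `\` S.
  apply/fsetP => v; rewrite !inE negb_or.
  by case: (boolP (v \in C)) => [/CS ->|_] //; rewrite andbT.
have UrC : (U `\` rv `\` (d `|` C)) `\` S = (U `\` rv `\` d) `\` S.
  apply/fsetP => v; rewrite !inE negb_or.
  by case: (boolP (v \in C)) => [/CS ->|_] //; rewrite andbT.
have Ur : (U `\` rv `\` d) `&` S = (U `\` d) `&` S.
  apply/fsetP => v; rewrite !inE; have := rvS v; rewrite inE.
  case: (v \in U); case: (v \in rv); case: (v \in S); rewrite /= ?andbF //.
  by move=> /(_ isT).
have UrC' : (U `\` rv `\` (d `|` C)) `&` S = (U `\` (d `|` C)) `&` S.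
  apply/fsetP => v; rewrite !inE; have := rvS v; rewrite inE.
  case: (v \in U); case: (v \in rv); case: (v \in S); rewrite /= ?andbF //.
  by move=> /(_ isT).
have sub1 : U `\` (d `|` C) `<=` U `\` d by apply: fsetDS; exact: fsubsetUl.
have sub2 : U `\` rv `\` d `<=` U `\` d by apply: fsetSD; exact: fsubsetDl.
have sub3 : U `\` rv `\` (d `|` C) `<=` U `\` d.
  by apply: fsubset_trans sub2; apply: fsetDS; exact: fsubsetUl.
rewrite (split (U `\` (d `|` C)) E) // (split (U `\` d) E) //.
rewrite (split (U `\` rv `\` d)) ?fsubsetDl //.
rewrite (split (U `\` rv `\` (d `|` C))) ?fsubsetDl //.
rewrite !lapP UC UrC Ur UrC' mulrACA [RHS]mulrACA; congr (_ * _).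
exact: mulrC.
Qed.

(** * Harmonic extensions *)

Section HarmonicDeterminant.
Variables (R : realType) (D : domain).
Let V := dom_verts D.
Let E := dom_edges D `\` neumann D.
Let U := V `\` dirichlet D.
Hypothesis EV : forall e, e \in dom_edges D -> (ends e).1 \in V /\ (ends e).2 \in V.
Implicit Types (h : vertex -> R) (alpha beta : {fset vertex}).

(** Zero increment along an edge has the effect of deleting it: this is how Neumann conditions match
    crossed edges. *)
Lemma laplacianE h v : laplacian D h v = lap E h v.
Proof.
rewrite /laplacian /lap; apply/esym.
transitivity (\sum_(e <- E) if (ends e).1 == v then increment D h e v (ends e).2
    else if (ends e).2 == v then increment D h e v (ends e).1 else 0).
  apply: eq_big_seq => e; rewrite inE => /andP[eN _].
  by rewrite /increment (negPf eN).
apply: big_fset_incl => [|e eD]; first exact: fsubsetDl.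
rewrite inE eD andbT negbK /increment => ->.
by case: ifP => // _; case: ifP.
Qed.

Definition extend (u : 'cV[R]_#|{: V}|) : vertex -> R :=
  fun v => \sum_j u j 0 * ind R (vtx j) v.

Lemma extend_vtx u i : extend u (vtx i) = u i 0.
Proof.
rewrite /extend (bigD1 i) //= big1 => [|j ji].
  by rewrite /ind eqxx mulr1 addr0.
by rewrite /ind (inj_eq (@vtx_inj _)) eq_sym (negPf ji) mulr0.
Qed.

Lemma extend_out u v : v \notin V -> extend u v = 0.
Proof.
move=> vV; rewrite /extend big1 // => j _; rewrite /ind.
by case: eqP => [vj|_]; rewrite ?mulr0 //; move: vV; rewrite vj vtx_in.
Qed.

Lemma eq_lap h h' v : {in V, h =1 h'} -> v \in V -> lap E h v = lap E h' v.
Proof.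
move=> hh vV; apply: eq_big_seq => e; rewrite inE => /andP[_ /EV[V1 V2]].
by rewrite /edge_lap !hh.
Qed.

Lemma lapmx_mulE W u i : (lapmx R V E W *m u) i 0
  = if vtx i \in W then - lap E (extend u) (vtx i) else u i 0.
Proof.
rewrite mxE; under eq_bigr => j _ do rewrite mxE.
case: ifP => _; last first.
  rewrite (bigD1 i) //= big1 => [|j ji]; first by rewrite eqxx mul1r addr0.
  by rewrite eq_sym (negPf ji) mul0r.
under eq_bigr => j _ do rewrite mulNr mulr_suml.
rewrite sumrN exchange_big; congr (- _); apply: eq_bigr => e _.
rewrite /edge_lap /extend.
case: ifP => _; last case: ifP => _; last by rewrite big1 // => j _; rewrite mul0r.
  by rewrite -sumrB; apply: eq_bigr => j _; rewrite mulrBl ![_ * u j 0]mulrC.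
by rewrite -sumrB; apply: eq_bigr => j _; rewrite mulrBl ![_ * u j 0]mulrC.
Qed.

Definition embed alpha (f : {ffun alpha -> R}) : 'cV[R]_#|{: V}| :=
  \col_i oapp f 0 (insub (vtx i)).

(** The matrix formula provides a solution, so the choice in [harm] falls on a solution, and by
    invertibility any two agree on [V]. Intersecting with [U] discards the data at Dirichlet
    vertices of [alpha], where 0 prevails. *)
Lemma harmE alpha beta (f : {ffun alpha -> R}) (x : beta)
    (i : 'I_#|{: V}|) :
  alpha `<=` V -> lapmx R V E (U `\` alpha) \in unitmx -> val x = vtx i ->
  harm D beta f x =
  (invmx (lapmx R V E (U `\` alpha)) *m (projmx R V (alpha `&` U) *m embed f)) i 0.
Proof.
set M := lapmx _ _ _ _ => /fsubsetP aV Mu xi; set u := _ *m _.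
have Mu_u : M *m u = projmx R V (alpha `&` U) *m embed f by rewrite mulKVmx.
rewrite /harm ffunE xi.
have sol : harmonic_extension D f (extend u).
  split=> [v vD|y yD|v vV vD va].
  - have [/vtxP[k kv]|vV] := boolP (v \in V); last exact: extend_out.
    move/colP: Mu_u => /(_ k); rewrite lapmx_mulE -kv extend_vtx projmxM !inE kv vD.
    by rewrite /= !(andbF, andFb).
  - have /vtxP[k ky] := aV _ (valP y); rewrite -ky extend_vtx.
    move/colP: Mu_u => /(_ k); rewrite lapmx_mulE projmxM !inE ky yD (valP y).
    by rewrite /= (aV _ (valP y)) /= => ->; rewrite mxE ky valK.
  - have [k kv] := vtxP vV; rewrite laplacianE -kv.
    move/colP: Mu_u => /(_ k); rewrite lapmx_mulE projmxM !inE kv vD vV (negPf va).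
    by move=> /= /eqP; rewrite oppr_eq0 => /eqP.
have [] := xgetPex (fun=> 0) (ex_intro _ _ sol).
set h := xget _ _ => h1 h2 h3; pose w : 'cV[R]_#|{: V}| := \col_k h (vtx k).
have hw : {in V, h =1 extend w}.
  by move=> _ /vtxP[k <-]; rewrite extend_vtx mxE.
rewrite hw ?vtx_in // extend_vtx; congr ((_ : 'cV_ _) i 0).
apply: (can_inj (mulKmx Mu)); rewrite Mu_u; apply/colP => k.
rewrite lapmx_mulE projmxM !inE vtx_in andbT.
have [kD|kD] := boolP (vtx k \in dirichlet D).
  by rewrite andbF /= andbF mxE h1.
have [ka|ka] /= := boolP (vtx k \in alpha).
  by rewrite !mxE insubT /= -(h2 [` ka]).
by rewrite -(eq_lap hw) ?vtx_in // -laplacianE h3 ?oppr0 ?vtx_in.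
Qed.

Lemma det_harmE (c d : {fset vertex}) : c `<=` V -> d `<=` V -> [disjoint c & d] ->
  \det (lapmx R V E (U `\` c)) != 0 -> \det (lapmx R V E (U `\` d)) != 0 ->
  \det (lapmx R V E (U `\` (d `|` c))) != 0 ->
  det_harm R D c d * \det (lapmx R V E (U `\` d)) * \det (lapmx R V E (U `\` c))
  = \det (lapmx R V E U) * \det (lapmx R V E (U `\` (d `|` c))).
Proof.
move=> cV dV cd.
rewrite -3!unitfE -!unitmxE => uc ud ucd.
have UI a : U `\` (a `&` U) = U `\` a.
  by apply/fsetP => v; rewrite !inE; case: (v \in a); case: (v \in V); case: (v \in dirichlet D).
set P := projmx R V (d `&` U : {fset vertex}); set Q := projmx R V (c `&` U : {fset vertex}).
have dis : [disjoint d `&` U & c `&` U].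
  apply/fdisjointP => v; rewrite !inE => /andP[vd _].
  by apply/negP => /andP[/(fdisjointP cd)]; rewrite vd.
have PQ : P *m Q = 0.
  rewrite /P projmxI; move: dis; rewrite -fsetI_eq0 => /eqP ->.
  by apply/matrixP => i j; rewrite !mxE inE andbF.
have QP : Q *m P = 0.
  rewrite /P projmxI fsetIC; move: dis; rewrite -fsetI_eq0 => /eqP ->.
  by apply/matrixP => i j; rewrite !mxE inE andbF.
have := @det_clamp2 _ _ (lapmx R V E U) P Q (projmx_id _ _ _) PQ QP.
rewrite /= projmxU // !clamp_lapmx -fsetIUl !UI => /(_ ud uc ucd) <-.
congr (_ * _ * _).
set MP := lapmx R V E (U `\` d); set MQ := lapmx R V E (U `\` c).
(* [B] extends by zero from [d] to [V] and its transpose restricts. Swapping factors under the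
   determinant twice turns the round trip on functions on [d] into the one over [V] with [P] at both
   ends. *)
pose B : 'M[R]_(#|{: V}|, #|{: d}|) :=
  \matrix_(i, j) (vtx i == val (enum_val j))%:R.
have BB : B *m B^T = projmx R V d.
  apply/matrixP => i j; rewrite !mxE.
  under eq_bigr => k _ do rewrite !mxE -natrM mulnb.
  have [id|id] := boolP (vtx i \in d); last first.
    rewrite andbF big1 // => k _; case: eqP => // ik.
    by rewrite ik (valP (enum_val k)) in id.
  rewrite (bigD1 (enum_rank [` id])) //= big1 => [|k].
    by rewrite enum_rankK eqxx andbT addr0 (inj_eq (@vtx_inj _)) eq_sym.
  move=> ki; case: eqP => // ik; case/negP: ki; apply/eqP.
  by apply: enum_val_inj; rewrite enum_rankK; exact: val_inj.
have Pd : P *m projmx R V d = P.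
  rewrite /P projmxI; congr projmx; apply/fsetP => v; rewrite !inE.
  by case: (v \in d); rewrite ?andbF ?andbT.
have Pid := projmx_id R V (d `&` U).
transitivity (\det (1%:M - B^T *m (invmx MQ *m Q *m invmx MP *m P *m B))).
  congr (\det _); apply/matrixP => i j.
  have opE (f g : {ffun d -> R}) x : (f - g) x = f x - g x by rewrite !ffunE.
  set N := invmx MQ *m Q *m invmx MP *m P *m B.
  have [k ki] := vtxP (fsubsetP dV _ (valP (enum_val i))).
  rewrite mxE opE [in X in X - _ = _]ffunE [in RHS]mxE [in RHS]mxE.
  rewrite [X in _ = _ + X]mxE (inj_eq enum_val_inj); congr (_ - _).
  have -> : (B^T *m N) i j = N k j.
    rewrite mxE (bigD1 k) //= big1 => [|l lk].
      by rewrite !mxE ki eqxx mul1r addr0.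
    by rewrite !mxE -ki (inj_eq (@vtx_inj _)) (negPf lk) mul0r.
  have -> : N k j = col j N k 0 by rewrite [RHS]mxE.
  rewrite colE /N -!mulmxA -colE (harmE _ cV uc (esym ki)); congr ((_ *m _) k 0).
  apply/colP => l; rewrite !projmxM; case: ifP => //.
  rewrite inE => /andP[lc lU]; rewrite mxE insubT /= (@harmE _ _ _ _ l) //.
  congr ((_ *m (_ *m _)) l 0); apply/colP => m; rewrite !mxE.
  case: insubP => [y yd ym|yd] /=.
    by rewrite ffunE -(inj_eq val_inj) ym.
  by case: eqP => // mj; move: yd; rewrite mj (valP (enum_val j)).
apply: (etrans (det_1BmulC _ _)).
rewrite -(mulmxA _ B) BB -(mulmxA _ P) Pd -!mulmxA; apply/esym.
by apply: (etrans (det_1BmulC _ _)); rewrite -!mulmxA Pid.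
Qed.

End HarmonicDeterminant.

(** * Initial segments of the exploration *)

(** The contour unfolded step by step: [q] moves while [q0] stays the point of return, as induction
    requires. *)
Fixpoint run (S : {fset edge}) (q0 : qpoint) (n : nat) (q : qpoint) : seq qpoint :=
  if n is n'.+1 then
    let q' := explore S q in q' :: (if q' == q0 then [::] else run S q0 n' q')
  else [::].

Lemma contourE N S q0 : contour N S q0 = q0 :: run S q0 N q0.
Proof.
rewrite /contour; congr (_ :: _); move: {2 3 5}q0 => q.
by elim: N q => //= n IH q; congr (_ :: _); case: eqP => _; rewrite ?take0.
Qed.

Notation steps g := (zip g (behead g)).

Lemma prefix_run_steps S q0 n q g st : prefix g (q :: run S q0 n q) ->
  st \in steps g -> st.2 = explore S st.1.
Proof.
elim: n q g => [|n IH] q [|x [|y g]] //=; first by rewrite andbF.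
case/and3P => /eqP -> /eqP -> pg; rewrite inE => /orP[/eqP -> //|].
move: pg; case: eqP => [_|_ pg]; first by case: g.
by apply: (IH (explore S q)); rewrite /= eqxx.
Qed.

Lemma prefix_run_agree S S' q0 n q g : prefix g (q :: run S q0 n q) ->
  (forall st, st \in steps g -> (ahead st.1 \in S) = (ahead st.1 \in S')) ->
  prefix g (q :: run S' q0 n q).
Proof.
elim: n q g => [|n IH] q [|x [|y g]] //=.
case/and3P => /eqP -> /eqP -> pg ag.
have eq : explore S q = explore S' q.
  by rewrite /explore (ag (q, explore S q)) // inE eqxx.
rewrite eqxx -eq eqxx /=; move: pg; case: eqP => // _ pg.
have := IH (explore S q) (explore S q :: g); rewrite /= eqxx; apply=> // st stg.
by apply: ag; rewrite inE stg orbT.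
Qed.

Lemma until_cons B q s : until B (q :: s) = q :: if B q then [::] else until B s.
Proof. by rewrite /until /=; case: (B q); rewrite ?take0. Qed.

Lemma until_run_agree B S S' q0 n q :
  (forall st, st \in steps (until B (q :: run S q0 n q)) ->
     (ahead st.1 \in S) = (ahead st.1 \in S')) ->
  until B (q :: run S' q0 n q) = until B (q :: run S q0 n q).
Proof.
elim: n q => [//|n IH] q; rewrite !(until_cons _ q) /=.
case: (B q) => // ag; congr (_ :: _).
have eq : explore S q = explore S' q.
  rewrite /explore (ag (q, explore S q)) //=.
  by rewrite until_cons /= inE eqxx.
rewrite -eq; move: ag; case: eqP => // _ ag; apply: IH => st stg.
by apply: ag; move: stg; rewrite until_cons /= inE => ->; rewrite orbT.
Qed.

(** The last point may lie in [B], but it starts no step; hence every inspected edge is seen from a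
    point outside [B]. *)
Lemma until_steps B g st : until B g = g -> st \in steps g -> ~~ B st.1.
Proof.
elim: g => [|x [|y g] IH] //; rewrite until_cons; case: ifP => // Bx ug.
rewrite /= inE => /orP[/eqP -> /=|]; first by rewrite Bx.
exact: (IH (congr1 behead ug)).
Qed.

Lemma until_id B s : until B (until B s) = until B s.
Proof.
by elim: s => // x s IH; rewrite until_cons; case: ifP => Bx; rewrite until_cons Bx // IH.
Qed.

(** The parities of the two coordinates tell which corner of its face a point is nearest to; local
    facts then reduce to four cases of linear arithmetic. *)
Lemma parity_halves (z : int) : exists a : int,
  [/\ odd `|z|%N = false, z = 2 * a, (z %/ 2)%Z = a & ((z + 1) %/ 2)%Z = a] \/
  [/\ odd `|z|%N = true, z = 2 * a + 1, (z %/ 2)%Z = a & ((z + 1) %/ 2)%Z = a + 1].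
Proof.
exists (z %/ 2)%Z; case: (boolP (odd `|z|%N)) => oz; [right|left]; split=> //; lia.
Qed.

Lemma vertexD (a b c d : int) : (a, b) + (c, d) = (a + c, b + d) :> vertex.
Proof. by []. Qed.

Lemma vertexN (a b : int) : - (a, b) = (- a, - b) :> vertex.
Proof. by []. Qed.

Definition vertexE := (vertexD, vertexN, xpair_eqE).

Ltac parity_cases q :=
  let x := fresh "x" in let y := fresh "y" in
  let ox := fresh in let oy := fresh in let xv := fresh in let yv := fresh in
  let xf := fresh in let yf := fresh in let xE := fresh in let yE := fresh in
  case: q => x y;
  have [? [[ox xE xf xv]|[ox xE xf xv]]] := parity_halves x;
  have [? [[oy yE yf yv]|[oy yE yf yv]]] := parity_halves y;
  rewrite /ahead /heading /q_face /q_vert /clockwise /ends /right /up /= !(ox, oy)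
    /= ?vertexE /= ?(xv, yv, xf, yf).

Lemma q_vert_heading q : q_vert (q + heading q) = q_vert q + heading q.
Proof. by parity_cases q; congr (_, _); lia. Qed.

Lemma q_vert_clockwise q : q_vert (q + clockwise (heading q)) = q_vert q.
Proof. by parity_cases q; congr (_, _); lia. Qed.

Lemma heading_neq0 q : heading q != 0.
Proof. by parity_cases q. Qed.

Lemma joins_ahead q : joins (ahead q) (q_vert q) (q_vert q + heading q).
Proof. by rewrite /joins; parity_cases q; lia. Qed.

Lemma ahead_corners q : (ends (ahead q)).1 \in corners (q_face q) /\
  (ends (ahead q)).2 \in corners (q_face q).
Proof. by rewrite /corners !inE; parity_cases q; lia. Qed.

(** The nearest vertex changes exactly when an edge is followed, so a path alone determines which
    edges it follows and which it crosses. *)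
Lemma exploreP S q : let q' := explore S q in
  if ahead q \in S then q_vert q' != q_vert q /\ joins (ahead q) (q_vert q) (q_vert q')
  else q_vert q' = q_vert q.
Proof.
move=> q'; rewrite {}/q'; case: ifP => aS; rewrite /explore aS; last exact: q_vert_clockwise.
rewrite q_vert_heading joins_ahead; split=> //.
by rewrite -subr_eq0 addrC addKr heading_neq0.
Qed.

Lemma vertsP F v : reflect (exists2 f, f \in F & v \in corners f) (v \in verts F).
Proof.
apply: (iffP (imfset2P _ _ _ _ _)) => [[f fF [w wf ->]]|[f fF vf]]; first by exists f.
by exists f => //; exists v.
Qed.

Lemma ends_verts F e : e \in edges F ->
  (ends e).1 \in verts F /\ (ends e).2 \in verts F.
Proof.
case/imfset2P => f /= fF [e' ef ->] {e}; move: e' ef => e; rewrite !inE => ef.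
suff [h1 h2] : (ends e).1 \in corners f /\ (ends e).2 \in corners f.
  by split; apply/vertsP; exists f.
case: e f ef {fF} => -[x y] b [z t]; rewrite /corners /ends /right /up !inE /= !vertexE /= => ef.
by split; case: b ef => ef; rewrite ?vertexE /=; lia.
Qed.

Lemma bd_edges_ends F e : e \in bd_edges F ->
  (ends e).1 \in bd_verts F /\ (ends e).2 \in bd_verts F.
Proof.
rewrite !inE => /andP[/ends_verts[h1 h2] /hasP[f fe fF]].
suff [m1 m2] : f \in faces_at (ends e).1 /\ f \in faces_at (ends e).2.
  by split; apply/andP; split=> //; apply/hasP; exists f.
case: e f fe {h1 h2 fF} => -[x y] b [z t]; rewrite /faces_along /faces_at /ends /right /up !inE /=.
by case: b; rewrite /= !vertexE /= => fe; split; lia.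
Qed.

Lemma zip_behead_in (T : eqType) (s : seq T) x y :
  (x, y) \in zip s (behead s) -> x \in s /\ y \in s.
Proof.
case: s => //= z s; elim: s z => //= w s IH z.
rewrite inE => /orP[/eqP[-> ->]|/IH[h1 h2]]; first by split; rewrite !inE eqxx ?orbT.
by move: h1 h2; rewrite !inE => -> ->; rewrite !orbT.
Qed.

Lemma curve_edges_ends E c e : e \in curve_edges E c ->
  (ends e).1 \in curve_verts c /\ (ends e).2 \in curve_verts c.
Proof.
rewrite !inE => /andP[_ /hasP[[x y] /zip_behead_in[xc yc]]].
by rewrite /joins => /orP[] /eqP ->.
Qed.

Lemma in_curve_verts c v : (v \in curve_verts c) = (v \in c).
Proof. by rewrite inE. Qed.

(** * Edges prescribed by an initial segment *)

Definition followed_edges (gamma : seq qpoint) : {fset edge} :=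
  [fset ahead st.1 | st in steps gamma & q_vert st.1 != q_vert st.2].

Lemma crossed_edgesP gamma e : reflect
  (exists2 st, st \in steps gamma & q_vert st.1 = q_vert st.2 /\ e = ahead st.1)
  (e \in crossed_edges gamma).
Proof.
apply: (iffP (imfsetP _ _ _ _)) => [[st /=]|[st sg [/eqP sv ->]]].
  by rewrite !inE => /andP[sg /eqP sv] ->; exists st.
by exists st => //=; rewrite !inE sg sv.
Qed.

Lemma followed_edgesP gamma e : reflect
  (exists2 st, st \in steps gamma & q_vert st.1 != q_vert st.2 /\ e = ahead st.1)
  (e \in followed_edges gamma).
Proof.
apply: (iffP (imfsetP _ _ _ _)) => [[st /=]|[st sg [sv ->]]].
  by rewrite !inE => /andP[sg sv] ->; exists st.
by exists st => //=; rewrite !inE sg sv.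
Qed.

Definition steered (gamma : seq qpoint) (S : {fset edge}) :=
  forall st, st \in steps gamma ->
    (ahead st.1 \in S) = (q_vert st.1 != q_vert st.2).

Lemma prefix_steered S q0 n q gamma :
  prefix gamma (q :: run S q0 n q) -> steered gamma S.
Proof.
move=> pg st sg; rewrite (prefix_run_steps pg sg) eq_sym.
by have /= := exploreP S st.1; case: ifP => _; [case|move=> ->; rewrite eqxx].
Qed.

(** The return to [q0] and the bound [n] concern only the points of [gamma], so one edge set
    producing [gamma] settles them; for another, only the answers at the inspected edges matter. *)
Lemma prefix_runE S S' q0 n q gamma : prefix gamma (q :: run S q0 n q) ->
  prefix gamma (q :: run S' q0 n q) <-> steered gamma S'.
Proof.
move=> pg; split; first exact: prefix_steered.
move=> sS'; apply: (prefix_run_agree pg) => st sg.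
by rewrite sS' // (prefix_steered pg).
Qed.

Section Exploration.
Variables (F : {fset face}) (gamma : seq qpoint).
Let E := edges F.
Let W := bd_verts F.
Let bd := bd_edges F.
Let Q := followed_edges gamma `\` bd.
Let P := crossed_edges gamma.

(** Boundary edges are followed whether or not they are in [T], so [T] must contain only the
    followed edges off the boundary. [X] stands for the edges of the cut, never inspected. *)
Lemma steeredE (T X : {fset edge}) :
  (forall st, st \in steps gamma -> ahead st.1 \notin X) ->
  steered gamma (T `|` bd `|` X) <->
  [&& Q `<=` T, fdisjoint T P & fdisjoint P bd].
Proof.
move=> HX; split=> [sT|/and3P[/fsubsetP QT /fdisjointP TP /fdisjointP Pbd] st sg].
  have inS e : e \in P -> (e \notin T) && (e \notin bd).
    case/crossed_edgesP => st sg [sv ->]; have := sT st sg.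
    by rewrite sv eqxx !in_fsetU (negPf (HX _ sg)) orbF => /negbT; rewrite negb_or.
  apply/and3P; split.
  - apply/fsubsetP => e; rewrite inE => /andP[ebd /followed_edgesP[st sg [sv ee]]].
    by move: (sT st sg); rewrite sv -ee !in_fsetU (negPf ebd) ee (negPf (HX _ sg)) !orbF.
  - by rewrite fdisjoint_sym; apply/fdisjointP => e /inS /andP[].
  - by apply/fdisjointP => e /inS /andP[].
rewrite !in_fsetU (negPf (HX _ sg)) orbF; case: eqP => /= [sv|/eqP sv].
  have eP : ahead st.1 \in P by apply/crossed_edgesP; exists st.
  by rewrite (negPf (Pbd _ eP)) orbF; apply/negP => /TP; rewrite eP.
have [|ebd] := boolP (_ \in bd); first by rewrite orbT.
rewrite orbF; apply: QT; rewrite inE ebd; apply/followed_edgesP; by exists st.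
Qed.

Lemma steered_disjoint (S : {fset edge}) : steered gamma S -> fdisjoint Q P.
Proof.
move=> sS; apply/fdisjointP => e; rewrite inE => /andP[_ /followed_edgesP[st sg [sv ee]]].
apply/crossed_edgesP => -[st' sg' [sv' ee']].
by move: (sS st sg) (sS st' sg'); rewrite -ee -ee' sv sv' eqxx => ->.
Qed.

Variables (S0 : {fset edge}) (q0 : qpoint) (n : nat) (U : {fset vertex}).
Hypothesis prefix_gamma : prefix gamma (q0 :: run S0 q0 n q0).
Hypothesis q0U : q_vert q0 \notin U.
Hypothesis WU : [disjoint W & U].

Lemma merged_right_verts v : v \in right_verts gamma -> merged U Q (q_vert q0) v.
Proof.
case/imfsetP => q /= qg ->.
have hstep st : st \in steps gamma -> merged U Q (q_vert st.1) (q_vert st.2).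
  move=> sg; have /= := exploreP S0 st.1; rewrite -(prefix_run_steps prefix_gamma sg).
  case: ifP => aS => [[sv je]|->]; last exact: merged_refl.
  suff m : merged U Q (ends (ahead st.1)).1 (ends (ahead st.1)).2.
    case/orP: je => /eqP je; move: m; rewrite je //; exact: merged_sym.
  have [/bd_edges_ends[h1 h2]|ebd] := boolP (ahead st.1 \in bd).
    by apply: merged_out; apply: (fdisjointP WU).
  apply: merged_edge; rewrite inE ebd; apply/followed_edgesP; exists st => //.
  by rewrite eq_sym.
move: prefix_gamma qg hstep; case: gamma => // x g /= /andP[/eqP xq _]; rewrite -{}xq.
elim: g x => [|y g IH] x /=; first by rewrite inE => /eqP -> _; exact: merged_refl.
rewrite inE => /orP[/eqP -> _|qg hs]; first exact: merged_refl.
apply: (@merged_trans _ _ (q_vert y)); first by apply: (hs (x, y)); rewrite inE eqxx.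
by apply: IH => // st sg; apply: hs; rewrite inE sg orbT.
Qed.

(** The origin of the Dirichlet condition on the right side of [gamma]: the followed edges hang from
    a wired starting vertex, so contracting them wires every vertex passed. *)
Lemma merged_contract_right_verts x y :
  merged (U `\` right_verts gamma) fset0 x y <-> merged U Q x y.
Proof.
split; apply: merged_sub => [u v|e]; rewrite ?inE //.
- have out w : ~~ ((w \notin right_verts gamma) && (w \in U)) -> merged U Q (q_vert q0) w.
    rewrite negb_and negbK => /orP[|wU]; first exact: merged_right_verts.
    exact: merged_out.
  by move=> /out h1 /out h2; apply: merged_trans (merged_sym h1) h2.
- by move=> uU vU; apply: merged_out; rewrite inE ?(negPf uU) ?(negPf vU) andbF.
case/andP => ebd /followed_edgesP[st sg [sv ee]].
have qv q : q \in gamma -> q_vert q \notin U `\` right_verts gamma.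
  by move=> qg; rewrite inE negb_and negbK; apply/orP; left; apply/imfsetP; exists q.
have /= := exploreP S0 st.1; rewrite -(prefix_run_steps prefix_gamma sg).
have [g1 g2] : st.1 \in gamma /\ st.2 \in gamma.
  by apply: zip_behead_in; rewrite -surjective_pairing.
case: ifP => _ => [[_ je]|vv]; last by rewrite vv eqxx in sv.
rewrite ee; suff : merged (U `\` right_verts gamma) fset0
  (ends (ahead st.1)).1 (ends (ahead st.1)).2 by [].
by case/orP: je => /eqP ->; apply: merged_out; exact: qv.
Qed.

Lemma card_trees_steered (X : {fset edge}) :
  (forall st, st \in steps gamma -> ahead st.1 \notin X) ->
  forest U Q -> Q `<=` E -> fdisjoint Q P -> fdisjoint P bd ->
  #|` [fset T in trees U E | prefix gamma (q0 :: run (T `|` bd `|` X) q0 n q0)]|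
  = #|` trees (U `\` right_verts gamma) (E `\` P)|.
Proof.
move=> HX fQ QE QP Pbd.
rewrite -(card_trees_contract merged_contract_right_verts fQ QE QP).
congr #|` _|; apply/fsetP => T; rewrite !inE /=; congr (_ && _).
apply/idP/idP => [/(prefix_runE _ prefix_gamma)/(steeredE _ HX)/and3P[-> ->]//|TQ].
by apply/(prefix_runE _ prefix_gamma)/(steeredE _ HX); rewrite andbA TQ.
Qed.

End Exploration.

(** Sending all of [C] to the wired vertex [o] carries links made after wiring [C] back to links
    made before; the ends of edges of [Q] stay fixed, as they avoid [C]. *)
Lemma forest_avoid (U C : {fset vertex}) (Q : {fset edge}) o : o \notin U ->
  (forall e, e \in Q -> (ends e).1 \notin C /\ (ends e).2 \notin C) ->
  forest U Q -> forest (U `\` C) Q.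
Proof.
move=> oU QC fQ e eQ h; apply: (fQ e eQ).
pose phi v := if v \in C then o else v.
suff H x y : merged (U `\` C) (Q `\ e) x y -> merged U (Q `\ e) (phi x) (phi y).
  by move: (H _ _ h); rewrite /phi; have [/negPf -> /negPf ->] := QC _ eQ.
elim => {x y} [x|x y xU yU|f|x y _|y x z _ + _].
- exact: merged_refl.
- have out w : w \notin U `\` C -> phi w \notin U.
    by rewrite /phi inE; case: ifP.
  by apply: merged_out; exact: out.
- rewrite inE => /andP[fe fQ']; rewrite /phi; have [/negPf -> /negPf ->] := QC _ fQ'.
  by apply: merged_edge; rewrite inE fe.
- exact: merged_sym.
- exact: merged_trans.
Qed.

(** The cut starts at a wired vertex, so its edges link all of it to the wired class and make up for
    no longer wiring it. *)
Lemma spans_cut (U : {fset vertex}) (E E' T : {fset edge}) x p : x \notin U ->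
  path (adjacent E) x p ->
  (forall e, e \in E -> (ends e).1 \in x :: p -> (ends e).2 \in x :: p -> e \in E') ->
  T `<=` E' -> spans (U `\` curve_verts (x :: p)) T -> spans U E'.
Proof.
move=> xU pE EE /fsubsetP TE sT.
have xv v : v \in x :: p -> merged U E' x v.
  elim: p x pE EE {xU sT} => [|y p IH] x.
    by move=> _ _; rewrite inE => /eqP ->; exact: merged_refl.
  case/andP => /hasP[e eE exy] pE EE; rewrite inE => /orP[/eqP ->|vp].
    exact: merged_refl.
  have EE' f : f \in E -> (ends f).1 \in y :: p -> (ends f).2 \in y :: p -> f \in E'.
    by move=> fE h1 h2; apply: EE => //; rewrite inE (h1, h2) orbT.
  apply: (@merged_trans _ _ y); last exact: IH.
  have eE' : e \in E'.
    have := EE e eE; case/orP: (exy) => /eqP ->; rewrite !inE !eqxx ?orbT;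
      by apply.
  by case/orP: exy (merged_edge U eE') => /eqP -> //; exact: merged_sym.
move=> u v; apply: merged_sub (sT u v) => [a b|e /TE]; last exact: merged_edge.
have out w : w \notin U `\` curve_verts (x :: p) -> merged U E' x w.
  rewrite inE negb_and negbK => /orP[|wU]; last exact: merged_out.
  by rewrite in_curve_verts; exact: xv.
by move=> /out h1 /out h2; apply: merged_trans (merged_sym h1) h2.
Qed.

(** * Explorations stopped near a cut *)

Lemma outer_bd_sub A : outer_bd A `<=` bd_verts (faces A).
Proof.
apply/fsubsetP => v; rewrite !inE => /andP[vV /hasP[f fv fF]].
apply/andP; split=> //; apply/hasP; exists f => //.
by move: fF; rewrite inE negb_or => /andP[].
Qed.

Lemma bd_verts_sub F : bd_verts F `<=` verts F.
Proof. by apply/fsubsetP => v; rewrite !inE => /andP[]. Qed.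

Lemma cut_sub A c : is_cut A c -> curve_verts c `<=` verts (faces A).
Proof.
case: c => // x p /and4P[_ px xo _]; apply/fsubsetP => v; rewrite in_curve_verts.
have xV : x \in verts (faces A).
  by apply: (fsubsetP (bd_verts_sub _)); exact: (fsubsetP (outer_bd_sub A)).
elim: p x px xV {xo} => [|y p IH] x px xV; first by rewrite inE => /eqP ->.
rewrite inE => /orP[/eqP -> //|]; case/andP: px => /hasP[e /ends_verts[h1 h2] je] py.
by apply: IH => //; case/orP: je h1 h2 => /eqP ->.
Qed.

Lemma not_near (R : realType) (delta eps : R) c q v : ~~ near delta eps c q ->
  v \in corners (q_face q) -> forall u, u \in curve_verts c -> eps < dist delta v u.
Proof.
move=> /hasPn nq /nq /hasPn nv u; rewrite in_curve_verts => /nv.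
by rewrite -ltNge.
Qed.

Lemma dist_id (R : realType) (delta : R) v : dist delta v v = 0.
Proof. by rewrite /dist !subrr expr0n addr0 sqrtr0 mulr0. Qed.

Lemma uniform_prob_neq0 (R : realType) (X : {fset {fset edge}}) ev :
  uniform_prob R X ev != 0 <-> exists2 T, T \in X & ev T.
Proof.
rewrite /uniform_prob mulf_eq0 invr_eq0 !pnatr_eq0 !cardfs_eq0 negb_or.
split=> [/andP[/fset0Pn[T]]|[T TX evT]].
  by rewrite !inE => /andP[TX evT] _; exists T.
apply/andP; split; apply/fset0Pn; exists T => //.
by rewrite !inE; apply/andP.
Qed.

Lemma in_steps (g : seq qpoint) x q : q \in x :: g ->
  q = x \/ exists2 st, st \in steps (x :: g) & st.2 = q.
Proof.
elim: g x => [|y g IH] x; first by rewrite inE => /eqP ->; left.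
rewrite in_cons => /orP[/eqP ->|]; first by left.
move=> /IH[->|[st sg <-]]; right; last by exists st; rewrite // inE sg orbT.
by exists (x, y); rewrite // inE eqxx.
Qed.

(** The letter [s] marks the slit domain, [c] and [d] the additional wired sets; [dA] and [dS] are
    the harmonic determinants of annulus and slit domain. *)
Lemma quotient_ratio (R : realType) (Z Zc Zd Zdc Zs Zsc Zsd Zsdc dA dS : R) :
  Z != 0 -> Zc != 0 -> Zd != 0 -> Zdc != 0 -> Zsc != 0 -> Zsd != 0 ->
  dA * Zd * Zc = Z * Zdc -> dS * Zsd * Zsc = Zs * Zsdc -> Zdc * Zsd = Zd * Zsdc ->
  dA != 0 /\ Zs / Z / (Zsc / Zc) = dS / dA.
Proof.
move=> Z0 Zc0 Zd0 Zdc0 Zsc0 Zsd0 eA eS eD.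
have -> : dA = Z * Zdc / (Zd * Zc) by rewrite -eA; field; rewrite ?Zd0 ?Zc0.
have -> : dS = Zs * Zsdc / (Zsd * Zsc) by rewrite -eS; field; rewrite ?Zsd0 ?Zsc0.
split; first by apply: mulf_neq0; rewrite ?invr_eq0; apply: mulf_neq0.
have -> : Zsdc = Zdc * Zsd / Zd by rewrite eD; field.
by field; rewrite Zc0 Zd0 Zsd0 Zsc0 Z0 Zdc0.
Qed.

Section Cut.
Variables (R : realType) (delta eps : R) (A : annulus) (q0 : qpoint) (c : seq vertex).
Let F := faces A.
Let V := verts F.
Let E := edges F.
Let W := bd_verts F.
Let U := V `\` W.
Let C := curve_verts c.
Let B := near delta eps c.
Let bd := bd_edges F.
Let N := (4 * #|` F|)%N.
Hypothesis eps_gt0 : 0 < eps.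
Hypothesis q0_out : q_vert q0 \in outer_bd A.
Hypothesis cut_c : is_cut A c.

Definition far v := forall u, u \in C -> eps < dist delta v u.

Lemma far_notin v : far v -> v \notin C.
Proof.
by move=> fv; apply/negP => /fv; rewrite dist_id ltNge (ltW eps_gt0).
Qed.

Lemma q0_notin : q_vert q0 \notin U.
Proof.
by rewrite inE negb_and negbK (fsubsetP (outer_bd_sub A)).
Qed.

Lemma disjoint_bd U' : [disjoint W & U `\` U'].
Proof. by apply/fdisjointP => v vW; rewrite !in_fsetD vW /= andbF. Qed.

Section Stopped.
Variable gamma : seq qpoint.
Hypothesis stopped : until B gamma = gamma.
Let Q := followed_edges gamma `\` bd.
Let P := crossed_edges gamma.

Lemma ahead_far st : st \in steps gamma ->
  far (ends (ahead st.1)).1 /\ far (ends (ahead st.1)).2.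
Proof.
move=> /(until_steps stopped) nB; have [h1 h2] := ahead_corners st.1.
by split; exact: not_near nB _.
Qed.

Lemma ahead_notin_curve st : st \in steps gamma -> ahead st.1 \notin curve_edges E c.
Proof.
move=> /ahead_far[/far_notin h _]; apply/negP => /curve_edges_ends[].
by rewrite (negPf h).
Qed.

Lemma followed_notin e : e \in Q -> (ends e).1 \notin C /\ (ends e).2 \notin C.
Proof.
rewrite inE => /andP[_ /followed_edgesP[st /ahead_far[h1 h2] [_ ->]]].
by split; exact: far_notin.
Qed.

Lemma crossed_far e : e \in P -> far (ends e).1 /\ far (ends e).2.
Proof. by case/crossed_edgesP => st /ahead_far h [_ ->]. Qed.

(** The last point, possibly near the cut, is covered too: its vertex is an end of the edge
    inspected just before. The starting vertex is not in [U]. *)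
Lemma right_verts_far S n v : prefix gamma (q0 :: run S q0 n q0) ->
  v \in right_verts gamma -> v \in U -> far v.
Proof.
move=> pg /imfsetP[q /= qg ->] qU.
have : exists2 st, st \in steps gamma & st.2 = q.
  case: gamma pg qg => // x g /= /andP[/eqP -> _] /in_steps[qq0|//].
  by move: q0_notin; rewrite -qq0 qU.
case=> st sg <-; have /= := exploreP S st.1; rewrite -(prefix_run_steps pg sg).
have [h1 h2] := ahead_far sg.
case: ifP => _ => [[_]|->]; last have := joins_ahead st.1.
  by case/orP => /eqP je; move: h1 h2; rewrite je.
by case/orP => /eqP je; move: h1 h2; rewrite je.
Qed.

End Stopped.

(** [T'] comes from a count: [T] avoids the crossed edges, so it still spans the slit domain once
    [C] is wired as well, and the number of trees of the cut domain starting by [gamma] is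
    positive. *)
Lemma exploration_transfer T : T \in trees U E -> exists2 T',
  T' \in trees (U `\` C) E &
  until B (exploration F c q0 T') = until B (exploration F [::] q0 T).
Proof.
rewrite /exploration !contourE -/N.
set S0 := _ `|` curve_edges _ [::]; set gamma := until B (q0 :: run S0 _ _ _).
move=> /in_trees[/fsubsetP TE [sT fT]].
have stop : until B gamma = gamma by exact: until_id.
have pg : prefix gamma (q0 :: run S0 q0 N q0) by exact: prefix_take.
have nil_edges st : st \in steps gamma -> ahead st.1 \notin curve_edges E [::].
  by move=> _; apply/negP => /curve_edges_ends[]; rewrite in_curve_verts.
have sg := prefix_steered pg.
have /and3P[QT TP Pbd] := (steeredE F T nil_edges).1 sg.
have QP := steered_disjoint F sg.
have QE : followed_edges gamma `\` bd `<=` E.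
  by apply/fsubsetP => e /(fsubsetP QT) /TE.
have fQ := forest_avoid q0_notin (followed_notin stop) (forest_sub QT fT).
have q0UC : q_vert q0 \notin U `\` C by rewrite inE negb_and q0_notin orbT.
have := card_trees_steered pg q0UC (disjoint_bd C) (ahead_notin_curve stop) fQ QE QP Pbd.
have : (0 < #|` trees (U `\` C `\` right_verts gamma) (E `\` crossed_edges gamma)|)%N.
  apply: trees_gt0 => x y; apply: merged_mono (sT x y).
    by rewrite (fsubset_trans (fsubsetDl _ _)) ?fsubsetDl.
  by apply/fsubsetP => e eT; rewrite inE (fdisjointP TP _ eT) TE.
move=> /[swap] <-; rewrite cardfs_gt0 => /fset0Pn[T']; rewrite !inE.
move=> /andP[T't pT']; exists T'; first by rewrite !inE.
rewrite contourE /gamma; apply: until_run_agree => st stg.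
by rewrite (prefix_steered pg) // (prefix_steered pT').
Qed.

Lemma ust_cutE (ev : pred {fset edge}) :
  ust_prob R F c ev = uniform_prob R (trees (U `\` C) E) ev.
Proof. by rewrite /ust_prob wired_treesE fsetDDl. Qed.

Lemma ust_nilE (ev : pred {fset edge}) :
  ust_prob R F [::] ev = uniform_prob R (trees U E) ev.
Proof.
rewrite /ust_prob; have -> : curve_verts [::] = fset0.
  by apply/fsetP => v; rewrite in_curve_verts inE.
by rewrite fsetU0 wired_treesE.
Qed.

Variables (d : {fset vertex}) (gamma : seq qpoint).
Hypothesis d_sub : d `<=` V.
Hypothesis disjoint_c_d : [disjoint C & d].
Hypothesis d_disconnects : disconnects delta eps E d C.
Hypothesis stopped : until B gamma = gamma.
Let P := crossed_edges gamma.
Let rv := right_verts gamma.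

(** The separating set consists of what the cut can reach without meeting [d]. The unwired vertices
    on the right of [gamma] and the ends of crossed edges are far from the cut, hence outside this
    set. *)
Lemma det_decouple S n : prefix gamma (q0 :: run S q0 n q0) ->
  \det (lapmx R V E (U `\` (d `|` C))) * \det (lapmx R V (E `\` P) (U `\` rv `\` d))
  = \det (lapmx R V E (U `\` d)) * \det (lapmx R V (E `\` P) (U `\` rv `\` (d `|` C))).
Proof.
move=> pg.
pose reach v := exists x p, [/\ x \in C, path (adjacent E) x p, last x p = v &
  ~~ has (fun v => v \in d) (x :: p)].
pose near_c := [fset v in V | `[< reach v >]].
have reachP v : reflect (v \in V /\ reach v) (v \in near_c).
  by rewrite !inE; apply: (iffP andP) => -[h1 /asboolP].
have far_near v : far v -> v \notin near_c.
  move=> fv; apply/reachP => -[_ [x [p [xC pE lv]]]]; apply/negP/negPn.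
  by apply: d_disconnects xC pE _; rewrite lv.
apply: (@det_lapmx_decouple _ _ _ near_c).
- move=> e x y eE exy /reachP[_ [z [p [zC pE lp np]]]]; rewrite !in_fsetD.
  move=> /and3P[yd _ yV]; apply/reachP; split=> //; exists z, (rcons p y).
  split=> //; rewrite ?last_rcons //.
    by rewrite rcons_path pE lp; apply/hasP; exists e.
  by rewrite -rcons_cons has_rcons negb_or yd.
- apply/fsubsetP => v vC; apply/reachP; split; first exact: (fsubsetP (cut_sub cut_c)).
  by exists v, [::]; split=> //=; rewrite orbF (fdisjointP disjoint_c_d).
- apply/fdisjointP => v; rewrite in_fsetI => /andP[vU vr]; apply: far_near.
  exact: right_verts_far pg vr vU.
- by move=> e /(crossed_far stopped)[/far_near h1 /far_near h2].
Qed.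

Theorem exploration_ratio :
  0 < ust_prob R F c (fun T => prefix gamma (exploration F c q0 T)) ->
  det_harm R (annulus_domain F) C d != 0 /\
  ust_prob R F [::] (fun T => prefix gamma (exploration F [::] q0 T))
    / ust_prob R F c (fun T => prefix gamma (exploration F c q0 T))
  = det_harm R (slit_domain F gamma) C d
    / det_harm R (annulus_domain F) C d.
Proof.
rewrite ust_cutE ust_nilE => /lt0r_neq0/uniform_prob_neq0[T /in_trees[/fsubsetP TE [sT fT]]].
rewrite /exploration contourE => pg.
have nil_edges st : st \in steps gamma -> ahead st.1 \notin curve_edges E [::].
  by move=> _; apply/negP => /curve_edges_ends[]; rewrite in_curve_verts.
have c_edges := ahead_notin_curve stopped.
have sg := prefix_steered pg.
have /and3P[QT TP Pbd] := (steeredE F T c_edges).1 sg.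
have QP := steered_disjoint F sg.
have QE : followed_edges gamma `\` bd `<=` E.
  by apply/fsubsetP => e /(fsubsetP QT) /TE.
have fQ := forest_sub QT fT.
have fQU : forest U (followed_edges gamma `\` bd).
  by move=> e eQ h; apply: (fQ e eQ); apply: merged_mono h => //; exact: fsubsetDl.
have q0UC : q_vert q0 \notin U `\` C by rewrite inE negb_and q0_notin orbT.
have dW : [disjoint W & U] by have := disjoint_bd fset0; rewrite fsetD0.
have nc := card_trees_steered pg q0UC (disjoint_bd C) c_edges fQ QE QP Pbd.
have nn := card_trees_steered pg q0_notin dW nil_edges fQU QE QP Pbd.
(* Edges of the cut are not crossed, so they may complete [T], which spans only when the cut is
   wired. *)
have spU : spans U (E `\` P).
  have TEP : T `<=` E `\` P.
    by apply/fsubsetP => e eT; rewrite inE (fdisjointP TP _ eT) TE.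
  have CP e : e \in E -> (ends e).1 \in C -> (ends e).2 \in C -> e \in E `\` P.
    move=> eE e1 _; rewrite inE eE andbT; apply/negP => /(crossed_far stopped)[+ _].
    by move=> /far_notin; rewrite e1.
  move: cut_c sT CP; rewrite /C; case: c => // x p /and4P[_ px xo _] sT CP.
  apply: (spans_cut _ px _ TEP sT) => [|e eE e1 e2].
    by rewrite inE negb_and negbK (fsubsetP (outer_bd_sub A)).
  by apply: CP; rewrite ?in_curve_verts.
have det0 U' E' : U' `<=` U -> E `\` P `<=` E' -> \det (lapmx R V E' U') != 0.
  move=> UU EE; rewrite matrix_tree; last exact: fsubset_trans UU (fsubsetDl _ _).
  rewrite pnatr_eq0 -lt0n; apply: trees_gt0 => x y.
  exact: merged_mono (spU x y).
have UV : U `<=` V := fsubsetDl _ _.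
have subU X X' : U `\` X `\` X' `<=` U by rewrite (fsubset_trans (fsubsetDl _ _)) ?fsubsetDl.
have Ur : verts F `\` (bd_verts F `|` rv) = U `\` rv by rewrite fsetDDl.
have EN : E `\` fset0 = E := fsetD0 _.
have CV := cut_sub cut_c.
have EV e : e \in E -> (ends e).1 \in V /\ (ends e).2 \in V by exact: ends_verts.
have hA := @det_harmE R (annulus_domain F) EV C d CV d_sub disjoint_c_d.
have hS := @det_harmE R (slit_domain F gamma) EV C d CV d_sub disjoint_c_d.
move: hA hS; rewrite /= EN Ur => hA hS.
have det0A X := det0 (U `\` X) E (fsubsetDl _ _) (fsubsetDl _ _).
have det0S X := det0 (U `\` rv `\` X) (E `\` P) (subU _ _) (fsubset_refl _).
have eA := hA (det0A _) (det0A _) (det0A _).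
have eS := hS (det0S _) (det0S _) (det0S _).
have probE c' U' : U' `<=` U ->
    #|` [fset T in trees U' E | prefix gamma
           (q0 :: run (T `|` bd `|` curve_edges E c') q0 N q0)]|
      = #|` trees (U' `\` rv) (E `\` P)| ->
    uniform_prob R (trees U' E) (fun T => prefix gamma (exploration F c' q0 T))
    = \det (lapmx R V (E `\` P) (U' `\` rv)) / \det (lapmx R V E U').
  move=> UU eN; have UV' : U' `<=` V := fsubset_trans UU UV.
  rewrite (matrix_tree _ _ UV') matrix_tree ?(fsubset_trans (fsubsetDl _ _)) //.
  rewrite -eN /uniform_prob; congr (#|` _|%:R / _).
  by apply/fsetP => T'; rewrite !inE /exploration contourE.
rewrite (probE c _ (fsubsetDl _ _) nc) (probE [::] _ (fsubset_refl _) nn).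
have UCr : U `\` C `\` rv = U `\` rv `\` C by apply/fsetP => v; rewrite !in_fsetD andbCA.
rewrite UCr.
apply: (quotient_ratio _ _ _ _ _ _ eA eS (det_decouple pg)); apply: det0;
  by rewrite ?fsubsetDl ?fsubset_refl ?subU.
Qed.

End Cut.

Theorem lemma2p37 (R : realType) (delta eps : R) (A : annulus)
    (a : vertex) (q0 : qpoint) (c d1 d2 : seq vertex) :
  let F := faces A in
  let C := curve_verts c in
  let d := curve_verts d1 `|` curve_verts d2 in
  let B := near delta eps c in
  0 < delta -> 0 < eps -> delta < eps ->
  a \in outer_bd A -> q_vert q0 = a -> q_face q0 \in F ->
  is_cut A c -> is_cut A d1 -> is_cut A d2 ->
  [disjoint C & d] ->
  disconnects delta eps (edges F) d C ->
  (forall X : pred (seq qpoint),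
     ust_prob R F c (fun T => X (until B (exploration F c q0 T))) = 0 ->
     ust_prob R F [::] (fun T => X (until B (exploration F [::] q0 T))) = 0)
  /\
  forall gamma : seq qpoint,
    until B gamma = gamma ->
    0 < ust_prob R F c (fun T => prefix gamma (exploration F c q0 T)) ->
    det_harm R (annulus_domain F) C d != 0 /\
    ust_prob R F [::] (fun T => prefix gamma (exploration F [::] q0 T))
      / ust_prob R F c (fun T => prefix gamma (exploration F c q0 T))
    = det_harm R (slit_domain F gamma) C d
      / det_harm R (annulus_domain F) C d.
Proof.
move=> F C d B _ eps_gt0 _ aA q0a _ cut_c cut_d1 cut_d2 Cd dis.
have q0A : q_vert q0 \in outer_bd A by rewrite q0a.
split=> [X|gamma stopped].
  (* By contraposition: a tree of the annulus realizing [X] is exchanged for one of the cut domain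
     with the same stopped exploration. *)
  rewrite ust_cutE ust_nilE => pc; apply/eqP/negPn/negP.
  move=> /uniform_prob_neq0[T Tt XT].
  have [T' Tt' eT] := exploration_transfer delta c eps_gt0 q0A Tt.
  move/eqP: pc; apply/negP/uniform_prob_neq0; exists T' => //.
  by rewrite /B eT.
apply: (exploration_ratio eps_gt0 q0A cut_c _ Cd dis stopped).
by rewrite fsubUset !cut_sub.
Qed.
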